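(* Let $(X,d,\mathfrak m)$ be a metric measure space, $p\in[1,\infty)$, $q\in(1,\infty]$ its conjugate exponent, and $\lambda\in\{0,1\}$. Let $\Gamma\subseteq R([0,1];X)$ be a compact set such that $0<\mathrm{Mod}_p^\lambda(\Gamma)<+\infty$. Then there exists a Borel probability measure $\pi_\Gamma$ on $\Gamma$ that admits $\lambda$-barycenter in $L^q(\mathfrak m)$ with $$\|\mathrm{Bar}_\lambda(\pi_\Gamma)\|_{L^q(\mathfrak m)}=\big(\mathrm{Mod}_p^\lambda(\Gamma)\big)^{-1/p}.$$
   Context: A metric measure space $(X,d,\mathfrak m)$ is a complete separable metric space with a non-negative Borel measure $\mathfrak m$ finite on bounded sets. $C([0,1];X)$ is endowed with the supremum distance and $R([0,1];X)$ is its subset of curves of finite length $\ell$. For $\gamma$ of finite length on $[a_\gamma,b_\gamma]$, $s_\gamma$ is the Borel measure on $[a_\gamma,b_\gamma]$ with $s_\gamma([s,t])=\ell(\gamma|_{[s,t]})$ and $\int_\gamma\rho\,ds=\int\rho\circ\gamma\,ds_\gamma$ for Borel $\rho:X\to[0,\infty]$. $\mathrm{Mod}^\lambda_p(\Gamma)$ is the infimum of $\int\rho^p\,d\mathfrak m$ over all Borel $\rho:X\to[0,\infty]$ such that $\lambda(\rho(\gamma_{a_\gamma})+\rho(\gamma_{b_\gamma}))+\int_\gamma\rho\,ds\ge1$ for every $\gamma\in\Gamma$ (with $0\cdot\infty=0$, $\inf\varnothing=\infty$). A plan is a finite non-negative Borel measure $\pi$ on $C([0,1];X)$ concentrated on $R([0,1];X)$.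 With $e_t(\gamma)=\gamma_t$, put $\Pi^\lambda_\pi=\lambda(e_0)_\#\pi+\lambda(e_1)_\#\pi+\int\gamma_\#s_\gamma\,d\pi(\gamma)$, i.e. $\int\rho\,d\Pi^\lambda_\pi=\int\big(\lambda\rho(\gamma_0)+\lambda\rho(\gamma_1)+\int_\gamma\rho\,ds\big)d\pi(\gamma)$ for every Borel $\rho:X\to[0,\infty]$. The plan $\pi$ admits $\lambda$-barycenter in $L^q(\mathfrak m)$ if $\Pi^\lambda_\pi\ll\mathfrak m$ and $\mathrm{Bar}_\lambda(\pi):=\frac{d\Pi^\lambda_\pi}{d\mathfrak m}\in L^q(\mathfrak m)$. Measures on $\Gamma$ are regarded as measures on $C([0,1];X)$. *)

(* Defs.v *)
From HB Require Import structures.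
From mathcomp Require Import all_boot all_order all_algebra.
From mathcomp Require Import all_classical all_reals all_analysis.
From mathcomp Require Import measurable_realfun lra.

Set Implicit Arguments.
Unset Strict Implicit.
Unset Printing Implicit Defensive.

Import Order.TTheory GRing.Theory Num.Theory.
Import numFieldNormedType.Exports.

Local Open Scope classical_set_scope.
Local Open Scope ring_scope.

Definition borel (T : ptopologicalType) : Type := g_sigma_algebraType (@open T).

HB.instance Definition _ (T : ptopologicalType) :=
  Measurable.copy (borel T) (g_sigma_algebraType (@open T)).

(* [Complete] asks for a base point, so these spaces are nonempty. *)
#[short(type="completeMetricType")]
HB.structure Definition CompleteMetric (K : numDomainType) :=
  {M of Metric K M & Complete M}.

Definition separable (T : topologicalType) :=
  exists2 D : set T, countable D & dense D.

Definition metric_bounded (R : realType) (X : metricType R) (A : set X) :=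
  exists M : R, forall x y, A x -> A y -> mdist x y <= M.

Definition finite_on_bounded (R : realType) (X : completeMetricType R)
    (m : {measure set (borel X) -> \bar R}) :=
  forall A : set (borel X),
    measurable A -> metric_bounded (A : set X) -> (m A < +oo)%E.

Definition unitI (R : realType) : Type := set_type (`[0, 1]%classic : set R).

HB.instance Definition _ (R : realType) := SubChoice.on (unitI R).
HB.instance Definition _ (R : realType) := Uniform.on (unitI R).

Section unit_interval.
Variable R : realType.

Let itv0 : (0 : R) \in (`[0, 1]%classic : set R).
Proof. by rewrite inE /= in_itv /= lexx ler01. Qed.

Let itv1 : (1 : R) \in (`[0, 1]%classic : set R).
Proof. by rewrite inE /= in_itv /= lexx ler01. Qed.

Definition I0 : unitI R := exist _ 0 itv0.
Definition I1 : unitI R := exist _ 1 itv1.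

HB.instance Definition _ := isPointed.Build (unitI R) I0.

Lemma unitI_compact : compact [set: unitI R].
Proof.
move=> F FF _.
have [] := @segment_compact R 0 1 (set_val @ F) _ _.
  apply: (@filterS _ F _ setT) filterT => t _ /=.
  exact: set_mem (valP t).
move=> r [r01 clr]; exists (exist _ r (mem_set r01)); split=> // B U FB.
move=> -[_ [[V oV <-]] Vr VU].
have FvB : (set_val @ F) (set_val @` B).
  by apply: (@filterS _ F _ B) FB => t Bt; exists t.
have nV : nbhs (r : R) V by apply: open_nbhs_nbhs; split.
have [_ [[t Bt <-] Vt]] := clr _ _ FvB nV.
by exists t; split=> //; exact: VU.
Qed.

End unit_interval.

Definition curve (R : realType) (X : metricType R) : Type :=
  continuousType (unitI R) X.

HB.instance Definition _ (R : realType) (X : metricType R) :=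
  Choice.on (curve X).

Section curve_metric.
Variables (R : realType) (X : metricType R).
Implicit Types g h k : curve X.

Definition sup_dist g h : R := sup (range (fun t => mdist (g t) (h t))).

Lemma has_sup_dist g h : has_sup (range (fun t => mdist (g t) (h t))).
Proof.
split; first by exists (mdist (g (I0 R)) (h (I0 R))); exists (I0 R).
have cgh : continuous (fun t : unitI R => mdist (g t) (h t)).
  move=> t; have tF : Filter (nbhs t) := nbhs_filter t.
  apply/(@cvgrPdist_lt _ _ _ _ tF) => e e0; near=> s.
  have gts : mdist (g t) (g s) < e / 2.
    near: s; have /metricType_numDomainType.cvgrPdist_lt := @cts_fun _ _ g t.
    by apply; rewrite divr_gt0.
  have hts : mdist (h t) (h s) < e / 2.
    near: s; have /metricType_numDomainType.cvgrPdist_lt := @cts_fun _ _ h t.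
    by apply; rewrite divr_gt0.
  have t1 := metric_triangle (g t) (g s) (h t).
  have t2 := metric_triangle (g s) (h s) (h t).
  have t3 := metric_triangle (g s) (g t) (h s).
  have t4 := metric_triangle (g t) (h t) (h s).
  rewrite (metric_sym (h s)) in t2; rewrite (metric_sym (g s) (g t)) in t3.
  by rewrite [e]splitr ltr_norml; apply/andP; split;
    rewrite ?ltrBlDr ?ltrBrDr; lra.
have /compact_has_sup : compact (range (fun t : unitI R => mdist (g t) (h t))).
  apply: continuous_compact; last exact: unitI_compact.
  exact: continuous_subspaceT.
by case=> //; exists (mdist (g (I0 R)) (h (I0 R))); exists (I0 R).
Unshelve. all: by end_near. Qed.

Lemma mdist_sup_dist g h t : mdist (g t) (h t) <= sup_dist g h.
Proof. by apply: ub_le_sup; [have [] := has_sup_dist g h|exists t]. Qed.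

Let sup_dist_le g h M : (forall t, mdist (g t) (h t) <= M) -> sup_dist g h <= M.
Proof.
by move=> ghM; apply: ge_sup; [have [] := has_sup_dist g h|move=> _ [t _ <-]].
Qed.

Let sup_distxx g : sup_dist g g = 0.
Proof.
apply/eqP; rewrite eq_le; apply/andP; split.
  by apply: sup_dist_le => t; rewrite mdistxx.
exact: le_trans (mdist_ge0 _ _) (mdist_sup_dist g g (I0 R)).
Qed.

Let sup_dist_positivity g h : sup_dist g h = 0 -> g = h.
Proof.
move=> gh0; apply/continuousEP => t; apply: mdist_positivity.
by apply/eqP; rewrite eq_le mdist_ge0 andbT -gh0 mdist_sup_dist.
Qed.

Let sup_dist_sym g h : sup_dist g h = sup_dist h g.
Proof.
by apply/eqP; rewrite eq_le; apply/andP; split; apply: sup_dist_le => t;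
  rewrite metric_sym mdist_sup_dist.
Qed.

Let sup_dist_triangle h g k : sup_dist g k <= sup_dist g h + sup_dist h k.
Proof.
apply: sup_dist_le => t; rewrite (le_trans (metric_triangle _ (h t) _))//.
by rewrite lerD// mdist_sup_dist.
Qed.

HB.instance Definition _ := isMetric.Build R (curve X)
  sup_distxx sup_dist_positivity sup_dist_sym sup_dist_triangle.

End curve_metric.

HB.instance Definition _ (R : realType) (X : completeMetricType R) :=
  isPointed.Build (curve X) (cst point : continuousType (unitI R) X).

Section length.
Variables (R : realType) (X : completeMetricType R).
Implicit Types g : curve X.

(* The supremum runs over the partitions [a < s_1 < ... < s_k = b]; for [a = b]
   the only one is [::], of length 0. *)
Definition curve_length g (a b : unitI R) : \bar R :=
  ereal_sup [set (\sum_(0 <= i < size s)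
      mdist (g (nth b (a :: s) i)) (g (nth b (a :: s) i.+1)))%:E
    | s in [set s : seq (unitI R) |
            itv_partition (\val a) (\val b) (map \val s)]].

Definition rectifiable : set (curve X) :=
  [set g | (curve_length g (I0 R) (I1 R) < +oo)%E].

Definition is_length_measure g (s : {measure set (borel (unitI R)) -> \bar R}) :=
  rectifiable g /\ forall a b : unitI R, \val a <= \val b ->
    s [set t : borel (unitI R) | \val a <= \val (t : unitI R) <= \val b] =
    curve_length g a b.

(* For rectifiable [g] exactly one Borel measure satisfies
   [is_length_measure g]; the value [mzero] is only used for curves of infinite
   length, on which no plan is charged. *)
Definition length_measure g : {measure set (borel (unitI R)) -> \bar R} :=
  if pselect (exists s, is_length_measure g s) is left e
  then projT1 (cid e) else mzero.

Definition line_integral g (rho : borel X -> \bar R) : \bar R :=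
  (\int[length_measure g]_t rho (g t))%E.

End length.

Section modulus.
Variables (R : realType) (X : completeMetricType R).
Variables (m : {measure set (borel X) -> \bar R}) (lambda p : R).
Local Open Scope ereal_scope.

Definition admissible (Gamma : set (curve X)) (rho : borel X -> \bar R) :=
  [/\ measurable_fun [set: borel X] rho, forall x, 0 <= rho x &
    forall g, Gamma g ->
      1 <= lambda%:E * (rho (g (I0 R)) + rho (g (I1 R))) + line_integral g rho].

Definition modulus (Gamma : set (curve X)) : \bar R :=
  ereal_inf [set \int[m]_x (rho x `^ p) | rho in admissible Gamma].

End modulus.

Section barycenter.
Variables (R : realType) (X : completeMetricType R).
Variables (m : {measure set (borel X) -> \bar R}) (lambda : R).
Implicit Type pi : {finite_measure set (borel (curve X)) -> \bar R}.
Local Open Scope ereal_scope.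

Definition plan pi := pi.-negligible (~` @rectifiable R X).

Definition evaluation (t : unitI R) (g : borel (curve X)) : borel X :=
  (g : curve X) t.

Definition plan_measure pi (A : set (borel X)) : \bar R :=
  lambda%:E * pushforward pi (evaluation (I0 R)) A +
  lambda%:E * pushforward pi (evaluation (I1 R)) A +
  \int[pi]_g pushforward (length_measure g)
               ((g : curve X) : borel (unitI R) -> borel X) A.

Definition is_density (nu : set (borel X) -> \bar R) (f : borel X -> \bar R) :=
  [/\ measurable_fun [set: borel X] f, forall x, 0 <= f x &
    forall A, measurable A -> nu A = \int[m]_(x in A) f x].

(* The library's Radon-Nikodym derivative requires a finite measure, whereas
   [plan_measure pi] may be infinite. *)
Definition barycenter pi : borel X -> \bar R :=
  xget (cst 0) [set f | is_density (plan_measure pi) f].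

Definition admits_barycenter (q : \bar R) pi :=
  [/\ plan pi, plan_measure pi `<< m, is_density (plan_measure pi) (barycenter pi)
    & 'N[m]_q[barycenter pi] < +oo].

End barycenter.

(* Main.v *)
Require Import Defs.
From HB Require Import structures.
From mathcomp Require Import all_boot all_order all_algebra.
From mathcomp Require Import all_classical all_reals all_analysis.
From mathcomp Require Import measurable_realfun ess_sup_inf lra ring.

Set Implicit Arguments.
Unset Strict Implicit.
Unset Printing Implicit Defensive.

Import Order.TTheory GRing.Theory Num.Theory.
Import numFieldNormedType.Exports.

Local Open Scope classical_set_scope.
Local Open Scope ring_scope.

(** For a Borel weight [rho >= 0] and a curve [g] write [L rho g] for
    [lambda (rho g_0 + rho g_1) + \int_g rho ds], and put [M = Mod ^ (-1/p)].

    The plan measure of a probability [pi] on [Gamma] integrates [rho] to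
    [\int L rho dpi]. By the duality of L^p and L^q, the barycenter of [pi]
    exists and has L^q norm at most [M] as soon as
    [[
      \int L rho dpi <= M * |rho|_p     for every Borel rho >= 0,      (1)
    ]]
    ([density_ex] produces the density, [dual_Lnorm] bounds its norm). The
    norm cannot be smaller than [M]: for an admissible [rho], Hoelder's
    inequality gives [1 <= \int L rho dpi <= |rho|_p |Bar|_q], and [|rho|_p]
    comes as close to [1/M] as wanted. So the theorem is the existence of a
    probability on [Gamma] that satisfies (1), and this is a minimax statement:
    for each single [rho] there is almost a curve with [L rho g <= M * |rho|_p],
    since otherwise a multiple of [rho] would be admissible with a norm smaller
    than [1/M].

    The passage from one curve for each [rho] to one measure for all [rho] goes
    as follows. The pairs [(L rho, M * |rho|_p)] form a convex cone, so the
    Hahn-Banach theorem yields a mean (a monotone normalized linear form on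
    bounded functions) that sends every bounded [f <= L rho] below
    [M * |rho|_p] ([mean_minorant]). To get a countably additive measure
    out of the mean, parametrize the compact set [Gamma] by the Cantor space
    ([cantor_onto_compact]): there the clopen sets form an algebra on which, by
    compactness, finite additivity is already countable additivity, and the
    Caratheodory extension applies. A lower semicontinuous function on the
    Cantor space is the increasing limit of functions of finitely many
    coordinates, hence its integral obeys the bound of the mean
    ([cantor_lsc]). The result is (1) for those [rho] for which [L rho] is
    lower semicontinuous on [Gamma] ([compact_measure]).

    These include the multiples of indicators of open sets, because for open
    [U] the length of [g] inside [U] is a supremum of sums of distances
    [mdist (g a) (g x)] over arcs that [g] maps into [U]
    ([path_measure_open], [open_length_in]). Outer regularity of the measure
    [m], which is finite on balls, approximates every bounded simple function
    of bounded support from above, in L^p, by such weights, and (1) follows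
    for all Borel [rho >= 0] ([integral_le_Lnorm]).

    The length measure of a rectifiable curve is the Stieltjes measure of its
    length function, whose continuity comes from that of the curve
    ([length_measure_ex]). *)

(** * Linear minorants of sublinear functionals *)

Section hahn_banach.
Variables (R : realType) (V : lmodType R) (B : set V).
Hypotheses (BD : forall x y, B x -> B y -> B (x + y))
  (BZ : forall (t : R) x, B x -> B (t *: x)).

Definition sublinear (p : V -> R) :=
  (forall x y, B x -> B y -> p (x + y) <= p x + p y) /\
  (forall (t : R) x, B x -> 0 <= t -> p (t *: x) <= t * p x).

Let BN x : B x -> B (- x).
Proof. by move=> Bx; rewrite -scaleN1r; exact: BZ. Qed.

Let sublinear0 p x : B x -> sublinear p -> p 0 = 0.
Proof.
move=> Bx [pD pZ]; have B0 : B 0 by rewrite -(scale0r x); exact: BZ.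
have := pZ 0 0 B0 (lexx 0); rewrite scaler0 mul0r => p0.
by have := pD _ _ B0 B0; rewrite addr0; lra.
Qed.

Let sublinear_ge p x : B x -> sublinear p -> - p (- x) <= p x.
Proof.
move=> Bx sp; have p0 := sublinear0 Bx sp.
by have := sp.1 _ _ Bx (BN Bx); rewrite subrr p0; lra.
Qed.

Let sublinearZ p (t : R) x : B x -> sublinear p -> 0 <= t -> p (t *: x) = t * p x.
Proof.
move=> Bx sp; rewrite le_eqVlt => /predU1P[<-|t0].
  by rewrite scale0r mul0r (sublinear0 Bx).
apply/eqP; rewrite eq_le sp.2//= ?(ltW t0)//.
have := sp.2 t^-1 (t *: x) (BZ _ Bx); rewrite scalerA mulVf ?gt_eqF// scale1r.
have ti : 0 <= t^-1 by rewrite invr_ge0 ltW.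
by move=> /(_ ti); rewrite ler_pdivlMl//.
Qed.

(** Lowers [p] while pushing the value at [- y] down to [- p y]; a minimal [p]
    is unchanged by this, which makes it additive in the direction [y]. *)
Let minorize (p : V -> R) y x : R :=
  inf [set p (x + t *: y) - t * p y | t in [set t : R | 0 <= t]].

Let minorize_lb p y x : B x -> B y -> sublinear p ->
  has_inf [set p (x + t *: y) - t * p y | t in [set t : R | 0 <= t]].
Proof.
move=> Bx By sp; split; first by exists (p (x + 0 *: y) - 0 * p y); exists 0 => //=.
exists (- p (- x)) => _ [t /= t0 <-]; rewrite -(sublinearZ By sp t0).
have := sp.1 (x + t *: y) (- x) (BD Bx (BZ _ By)) (BN Bx).
by rewrite addrAC subrr add0r; lra.
Qed.

Let minorize_le p y x t : B x -> B y -> sublinear p -> 0 <= t ->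
  minorize p y x <= p (x + t *: y) - t * p y.
Proof.
move=> Bx By sp t0; apply: ge_inf; last by exists t.
by have [] := minorize_lb Bx By sp.
Qed.

Let minorize_ge p y x c : (forall t, 0 <= t -> c <= p (x + t *: y) - t * p y) ->
  c <= minorize p y x.
Proof.
move=> h; apply: lb_le_inf; first by exists (p (x + 0 *: y) - 0 * p y); exists 0 => //=.
by move=> _ [t t0 <-]; exact: h.
Qed.

Let sublinear_minorize p y : B y -> sublinear p -> sublinear (minorize p y).
Proof.
move=> By sp; split=> [x1 x2 B1 B2|t x Bx].
  rewrite -lerBlDl; apply: minorize_ge => t2 t20.
  rewrite lerBlDl -lerBlDr; apply: minorize_ge => t1 t10; rewrite lerBlDr.
  apply: (le_trans (minorize_le (BD B1 B2) By sp (addr_ge0 t10 t20))).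
  have := sp.1 _ _ (BD B1 (BZ t1 By)) (BD B2 (BZ t2 By)).
  by rewrite addrACA -scalerDl mulrDl; lra.
rewrite le_eqVlt => /predU1P[<-|t0].
  rewrite scale0r mul0r; have B0 : B 0 by rewrite -(scale0r x); exact: BZ.
  apply: (le_trans (minorize_le B0 By sp (lexx 0))).
  by rewrite scale0r addr0 mul0r subr0 (sublinear0 B0 sp).
rewrite -ler_pdivrMl//; apply: minorize_ge => s s0; rewrite ler_pdivrMl//.
apply: (le_trans (minorize_le (BZ _ Bx) By sp (mulr_ge0 (ltW t0) s0))).
rewrite mulrBr -scalerA -scalerDr mulrA lerD2r.
by apply: sp.2; [exact/BD/BZ|exact: ltW].
Qed.

(** A sublinear functional that is minimal for the pointwise order is linear,
    and Zorn's lemma gives a minimal one below [q]: the infimum of a chain of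
    sublinear functionals is sublinear. Working inside the set [B] allows [V] to
    be a space of all functions and [B] that of the bounded ones. *)
Lemma linear_minorant (q : V -> R) : sublinear q ->
  exists l : V -> R, [/\ forall x y, B x -> B y -> l (x + y) = l x + l y,
    forall (t : R) x, B x -> 0 <= t -> l (t *: x) = t * l x &
    forall x, B x -> l x <= q x].
Proof.
move=> sq.
pose S := {p : V -> R | sublinear p /\ forall x, B x -> p x <= q x}.
pose le (s t : S) := `[< forall x, B x -> sval t x <= sval s x >].
have [| | | [l [sl lq]] lmax] :=
  @ZL_preorder S (exist _ q (conj sq (fun _ _ => lexx _))) le.
- by move=> t; apply/asboolP => x Bx.
- move=> r s t /asboolP rs /asboolP st; apply/asboolP => x Bx.
  exact: le_trans (st _ Bx) (rs _ Bx).
- move=> A tA; have [[s0 As0]|A0] := pselect (A !=set0); last first.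
    exists (exist _ q (conj sq (fun _ _ => lexx _))) => s As.
    by exfalso; apply: A0; exists s.
  pose p x := inf [set sval s x | s in A].
  have p_lb x : B x -> has_inf [set sval s x | s in A].
    move=> Bx; split; first by exists (sval s0 x); exists s0.
    exists (- q (- x)) => _ [[s [ss sq']] _ <-] /=.
    by have := sublinear_ge Bx ss; have := sq' _ (BN Bx); lra.
  have p_le s x : A s -> B x -> p x <= sval s x.
    by move=> As Bx; apply: ge_inf; [have [] := p_lb x Bx|exists s].
  have p_ge c x : (forall s, A s -> c <= sval s x) -> c <= p x.
    move=> h; apply: lb_le_inf; first by exists (sval s0 x); exists s0.
    by move=> _ [s As <-]; exact: h.
  have sp : sublinear p.
    split=> [x y Bx By|t x Bx].
      rewrite -lerBlDl; apply: (@p_ge) => s As.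
      rewrite lerBlDl -lerBlDr; apply: (@p_ge) => s' As'; rewrite lerBlDr.
      have [/asboolP ss|/asboolP ss] := tA _ _ As As'.
        apply: (le_trans (p_le s' _ As' (BD Bx By))).
        have [[sD _] _] := svalP s'.
        by have := sD _ _ Bx By; have := ss y By; lra.
      apply: (le_trans (p_le s _ As (BD Bx By))).
      have [[sD _] _] := svalP s.
      by have := sD _ _ Bx By; have := ss x Bx; lra.
    rewrite le_eqVlt => /predU1P[<-|t0].
      rewrite scale0r mul0r; have B0 : B 0 by rewrite -(scale0r x); exact: BZ.
      have [ss0 _] := svalP s0.
      by rewrite -(sublinear0 B0 ss0); exact: p_le.
    rewrite -ler_pdivrMl//; apply: (@p_ge) => s As; rewrite ler_pdivrMl//.
    apply: (le_trans (p_le s _ As (BZ _ Bx))).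
    by have [[_ sZ] _] := svalP s; apply: sZ => //; exact: ltW.
  have pq x : B x -> p x <= q x.
    by move=> Bx; have [_ h] := svalP s0; apply: le_trans (h _ Bx); exact: p_le.
  exists (exist _ p (conj sp pq)) => s As; apply/asboolP => x Bx /=.
  exact: p_le.
(* By minimality [l x <= minorize l y x <= l (x + y) - l y]. *)
exists l; split=> // [x y Bx By|t x Bx t0]; last exact: sublinearZ.
apply/eqP; rewrite eq_le sl.1//=.
have sm := sublinear_minorize By sl.
have ml z : B z -> minorize l y z <= l z.
  by move=> Bz; have := minorize_le Bz By sl (lexx 0); rewrite scale0r addr0 mul0r subr0.
have mq z : B z -> minorize l y z <= q z.
  by move=> Bz; exact: le_trans (ml _ Bz) (lq _ Bz).
have /asboolP /(_ x Bx) /= lm := lmax (exist _ _ (conj sm mq)) ltac:(by apply/asboolP).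
have := minorize_le Bx By sl ler01; rewrite scale1r mul1r.
by lra.
Qed.

End hahn_banach.

(** * A mean dominated by a convex cone of functions *)
Definition bounded_fct (R : realType) (T : Type) (f : T -> R) :=
  exists c : R, forall t, `|f t| <= c.

Section mean.
Variables (R : realType) (T : Type) (K : (T -> R) -> R -> Prop).
Hypotheses (K0 : K (cst 0) 0)
  (KD : forall F G M N, K F M -> K G N -> K (F \+ G) (M + N))
  (KZ : forall (t : R) F M, 0 < t -> K F M -> K (t \*o F) (t * M))
  (K_inf : forall F N e, K F N -> 0 < e -> exists t, F t <= N + e).

(** The constant [c] makes the gauge of a constant equal to it, so that a linear
    form below the gauge is normalized and monotone. *)
Let gauge (f : T -> R) : R :=
  inf [set x | exists F N c, [/\ K F N, forall t, f t <= F t + c & x = N + c]].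

Let gauge_has_inf f : bounded_fct f ->
  has_inf [set x | exists F N c, [/\ K F N, forall t, f t <= F t + c & x = N + c]].
Proof.
move=> [b fb]; split.
  exists (0 + b), (cst 0), 0, b; split => // t; rewrite /= add0r.
  exact: le_trans (ler_norm _) (fb t).
exists (- b) => _ [F [N [c [KF fF ->]]]]; apply/ler_addgt0Pr => e e0.
have [t Ft] := K_inf KF e0; have := fF t; have := fb t.
by rewrite ler_norml => /andP[]; lra.
Qed.

Let gauge_le f F N c : bounded_fct f -> K F N -> (forall t, f t <= F t + c) ->
  gauge f <= N + c.
Proof.
move=> bf KF fF; apply: ge_inf; first by have [] := gauge_has_inf bf.
by exists F, N, c.
Qed.

Let gauge_ge f d : bounded_fct f ->
  (forall F N c, K F N -> (forall t, f t <= F t + c) -> d <= N + c) -> d <= gauge f.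
Proof.
move=> bf h; apply: lb_le_inf; first by have [] := gauge_has_inf bf.
by move=> _ [F [N [c [KF fF ->]]]]; exact: (h F).
Qed.

(** [K F N] reads as the constraint that [F] should have mean at most [N]. The
    hypothesis [K_inf] says that each constraint alone is met, up to [e], by the
    evaluation at one point; it is what keeps the gauge above [- sup |f|]. *)
Lemma mean_minorant : exists l : (T -> R) -> R,
  [/\ forall f g, bounded_fct f -> bounded_fct g -> l (f \+ g) = l f + l g,
      forall (t : R) f, bounded_fct f -> 0 <= t -> l (t \*o f) = t * l f,
      forall f c, bounded_fct f -> (forall t, f t <= c) -> l f <= c &
      forall f F N, bounded_fct f -> K F N -> (forall t, f t <= F t) -> l f <= N].
Proof.
pose B : set (T -> R) := @bounded_fct R T.
have BD (f g : T -> R) : B f -> B g -> B (f + g).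
  move=> [a fa] [b gb]; exists (a + b) => t.
  by apply: (le_trans (ler_normD _ _)); exact: lerD.
have BZ (t : R) (f : T -> R) : B f -> B (t *: f).
  by move=> [a fa]; exists (`|t| * a) => s; rewrite normrM ler_wpM2l.
have sg : sublinear B gauge.
  split=> [f g Bf Bg|t f Bf].
    rewrite -lerBlDl; apply: (gauge_ge Bg) => G N c KG gG.
    rewrite lerBlDl -lerBlDr; apply: (gauge_ge Bf) => F M d KF fF; rewrite lerBlDr.
    rewrite addrACA; apply: (gauge_le (BD _ _ Bf Bg) (KD KF KG)) => t.
    by rewrite /= addrACA; exact: lerD.
  rewrite le_eqVlt => /predU1P[<-|t_gt0].
    rewrite mul0r scale0r -[leRHS]addr0; apply: (gauge_le _ K0) => [|t'].
      by exists 0 => s; rewrite normr0.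
    by rewrite addr0.
  rewrite -ler_pdivrMl//; apply: (gauge_ge Bf) => F N c KF fF.
  rewrite ler_pdivrMl// mulrDr; apply: (gauge_le (BZ _ _ Bf) (KZ t_gt0 KF)) => s.
  by rewrite -mulrDr ler_wpM2l// ltW.
have [l [lD lZ lg]] := linear_minorant BD BZ sg.
exists l; split => //.
- move=> f c Bf fc; apply: (le_trans (lg _ Bf)); rewrite -[leRHS]add0r.
  by apply: (gauge_le Bf K0) => t; rewrite /= add0r.
- move=> f F N Bf KF fF; apply: (le_trans (lg _ Bf)); rewrite -[leRHS]addr0.
  by apply: (gauge_le Bf KF) => t; rewrite addr0.
Qed.

End mean.

(** * From means on the Cantor space to measures *)
Section cantor_cylinders.

Definition cylinder (x : cantor_space) (n : nat) : set cantor_space :=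
  [set y | forall i, (i < n)%N -> y i = x i].

Lemma clopen_cylinder x n : clopen (cylinder x n).
Proof.
elim: n => [|n ih].
  have -> : cylinder x 0 = setT by apply/seteqP; split.
  exact: clopenT.
have -> : cylinder x n.+1 = cylinder x n `&` (proj n @^-1` [set x n]).
  apply/seteqP; split => y /=.
    by move=> yx; split=> [i /= ni|]; [apply: yx; rewrite ltnS ltnW|exact: yx].
  move=> [yx yn] i; rewrite ltnS leq_eqVlt => /predU1P[->//|]; exact: yx.
apply: clopenI => //; apply: preimage_clopen; last exact: proj_continuous.
by split; [exact: discrete_open|exact: discrete_closed].
Qed.

Lemma cylinder_le x m n : (m <= n)%N -> cylinder x n `<=` cylinder x m.
Proof. by move=> mn y yx i im; apply: yx; exact: leq_trans mn. Qed.

(** The cylinders of [x] form a basis of neighbourhoods: the filter that they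
    generate has [x] as its only cluster point in a compact space. *)
Lemma cylinder_sub_open x (U : set cantor_space) : open U -> U x ->
  exists n, cylinder x n `<=` U.
Proof.
move=> oU Ux.
pose F := filter_from [set: nat] (cylinder x).
have FF : ProperFilter F.
  split; first by case => n _ P; apply: (P x).
  apply: filter_from_filter; first by exists 0%N.
  move=> i j _ _; exists (maxn i j) => //; rewrite subsetI.
  by split; apply: cylinder_le; [exact: leq_maxl|exact: leq_maxr].
have : F --> x.
  apply: (compact_cluster_set1 _ cantor_space_compact) => //; try exact: filterT.
    exact: cantor_space_hausdorff.
  apply/seteqP; split=> [y cly|_ ->]; last first.
    by move=> A B [n _ nA] /nbhs_singleton Bx; exists x; split => //; exact: nA.
  apply/funext => i /=.
  have [] := cly (cylinder x i.+1) (cylinder y i.+1).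
  - by exists i.+1.
  - by apply: open_nbhs_nbhs; split => //; exact: (clopen_cylinder y i.+1).1.
  by move=> z [zx zy]; rewrite -zx// -zy.
move=> /(_ U) []; first exact: open_nbhs_nbhs.
by move=> n _ nU; exists n.
Qed.

End cantor_cylinders.

(** The Cantor space whose measurable sets are the clopen ones: an algebra of
    sets that generates the Borel sets. *)
Definition clopen_space : Type := cantor_space.

HB.instance Definition _ := Pointed.on clopen_space.

Fact clopen_display : measure_display. Proof. exact. Qed.

HB.instance Definition _ := isAlgebraOfSets.Build clopen_display clopen_space
  (@clopen0 cantor_space) (@clopenU cantor_space)
  (fun A cA => @clopenC cantor_space A A cA).

Section cantor_measure.
Variables (R : realType) (l : (cantor_space -> R) -> R).
Hypotheses
  (lD : forall f g, bounded_fct f -> bounded_fct g -> l (f \+ g) = l f + l g)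
  (lZ : forall (t : R) f, bounded_fct f -> 0 <= t -> l (t \*o f) = t * l f)
  (l_le : forall f c, bounded_fct f -> (forall t, f t <= c) -> l f <= c).

Let bounded_cst (c : R) : bounded_fct (fun _ : cantor_space => c).
Proof. by exists `|c|. Qed.

Let bounded_indic (A : set cantor_space) : bounded_fct (\1_A : _ -> R).
Proof. by exists 1 => t; rewrite indicE; case: (_ \in _); rewrite ?normr0 ?normr1. Qed.

Local Hint Resolve bounded_indic : core.

Let lcst0 : l (cst 0) = 0.
Proof.
have E : 0 \*o (fun=> 0) = cst 0 :> (cantor_space -> R).
  by apply/funext => t /=; rewrite mulr0.
by have := lZ (bounded_cst 0) (lexx 0); rewrite E mul0r.
Qed.

Let lN f : bounded_fct f -> l (\- f) = - l f.
Proof.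
move=> bf; have bNf : bounded_fct (\- f).
  by have [c fc] := bf; exists c => t; rewrite normrN.
apply/eqP; rewrite -subr_eq0 opprK addrC -lD// -lcst0; apply/eqP; congr l.
by apply/funext => t /=; rewrite subrr.
Qed.

Let l_ge0 f : bounded_fct f -> (forall t, 0 <= f t) -> 0 <= l f.
Proof.
move=> bf f0; have bNf : bounded_fct (\- f).
  by have [c fc] := bf; exists c => t; rewrite normrN.
rewrite -oppr_le0 -lN//; apply: l_le => // t.
by rewrite oppr_le0.
Qed.

Let lcst1 : l (cst 1) = 1.
Proof.
apply/eqP; rewrite eq_le; apply/andP; split.
  by apply: l_le; [exact: bounded_cst|].
rewrite -lerN2 -lN; last exact: bounded_cst.
apply: l_le => //.
by exists 1 => t; rewrite normrN normr1.
Qed.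

Definition clopen_measure (A : set clopen_space) : \bar R :=
  (l (\1_(A : set cantor_space)))%:E.

Let clopen_measure0 : clopen_measure set0 = 0%E.
Proof. by rewrite /clopen_measure indic0 lcst0. Qed.

Let clopen_measure_ge0 A : (0 <= clopen_measure A)%E.
Proof. by rewrite lee_fin l_ge0. Qed.

Let clopen_measureU A B : A `&` B = set0 ->
  clopen_measure (A `|` B) = (clopen_measure A + clopen_measure B)%E.
Proof.
move=> AB; rewrite /clopen_measure -EFinD -lD//; congr (_ %:E); congr l.
apply/funext => t; rewrite /= !indicE in_setU.
have [tA|//] := boolP (t \in A); last by rewrite add0r.
have [tB|] := boolP (t \in B); last by rewrite addr0.
have : (A `&` B) t by split; exact: set_mem.
by rewrite AB.
Qed.

Let clopen_measure_bigsetU (F : (set clopen_space)^nat) n : trivIset setT F ->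
  clopen_measure (\big[setU/set0]_(i < n) F i) =
  (\sum_(0 <= i < n) clopen_measure (F i))%E.
Proof.
move=> tF; elim: n => [|n ih].
  by rewrite big_ord0 big_nil clopen_measure0.
rewrite big_ord_recr big_nat_recr//= clopen_measureU ?ih//.
apply/seteqP; split => // t [].
rewrite -bigcup_mkord => -[i /= iltn Fi] Fn.
by have := tF i n I I (ex_intro _ t (conj Fi Fn)) => ein; rewrite ein ltnn in iltn.
Qed.

(** A disjoint union of clopen sets that is clopen is compact, hence all but
    finitely many of its members are empty. *)
Let clopen_measure_sigma : semi_sigma_additive clopen_measure.
Proof.
move=> F mF tF mU.
have cU : compact (\bigcup_n F n : set cantor_space).
  by apply: (subclosed_compact mU.2 cantor_space_compact).
move: cU; rewrite compact_cover => /(_ nat setT F) [i _||D _ UD].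
- exact: (mF i).1.
- by [].
have [N DN] : exists N, forall i, (N <= i)%N -> F i = set0.
  exists (\max_(i <- finmap.enum_fset D) i).+1 => i Ni; apply/seteqP; split => // t Ft.
  have [j /= Dj Fj] := UD t (ex_intro2 _ _ i I Ft).
  have ji := tF i j I I (ex_intro _ t (conj Ft Fj)).
  have : (j <= \max_(i <- finmap.enum_fset D) i)%N by apply: leq_bigmax_seq.
  by move=> jm; move: (leq_ltn_trans jm Ni); rewrite ji ltnn.
have UE : \bigcup_n F n = \big[setU/set0]_(i < N) F i.
  rewrite -bigcup_mkord; apply/seteqP; split => t [i iN Fi]; exists i => //=.
  by rewrite ltnNge; apply/negP => Ni; move: Fi; rewrite DN.
rewrite UE clopen_measure_bigsetU//.
apply: cvg_near_cst; exists N => // n /= Nn; apply/eqP.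
rewrite (big_cat_nat (leq0n _) Nn)/= [X in (_ + X)%E]big1_seq ?adde0// => i /andP[_].
by rewrite mem_index_iota => /andP[Ni _]; rewrite DN// clopen_measure0.
Qed.

HB.instance Definition _ := isMeasure.Build _ _ _ clopen_measure
  clopen_measure0 clopen_measure_ge0 clopen_measure_sigma.

Definition cantor_measure := measure_extension clopen_measure.

HB.instance Definition _ := Measure.on cantor_measure.

Lemma cantor_measure_clopen A : clopen (A : set cantor_space) ->
  cantor_measure A = (l (\1_A))%:E.
Proof. by move=> cA; rewrite /cantor_measure /measure_extension measurable_mu_extE. Qed.

Lemma cantor_measureT : cantor_measure setT = 1%E.
Proof. by rewrite cantor_measure_clopen ?indicT ?lcst1//; exact: clopenT. Qed.

HB.instance Definition _ :=
  Measure_isProbability.Build _ _ _ cantor_measure cantor_measureT.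

Local Notation cantor_borel :=
  (g_sigma_algebraType (@measurable clopen_display clopen_space)).

Let cylinderC x y n : cylinder x n y -> cylinder y n = cylinder x n.
Proof.
move=> xy; apply/seteqP; split => z h i iltn; first by rewrite h ?xy.
by rewrite h// xy.
Qed.

(** Together with [prefix], identifies the cylinders of depth [n] with the
    tuples of [n] bits. *)
Let extend n (s : n.-tuple bool) : cantor_space := fun i => nth false s i.

Let prefix n (x : cantor_space) : n.-tuple bool := [tuple x i | i < n].

Let extendK n x : cylinder (extend (prefix n x)) n x.
Proof. by move=> i iltn; rewrite /extend (nth_mktuple _ _ (Ordinal iltn)). Qed.

Let extend_inj n (s : n.-tuple bool) x : cylinder (extend s) n x -> s = prefix n x.
Proof.
by move=> h; apply: eq_from_tnth => i; rewrite tnth_mktuple h// /extend -tnth_nth.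
Qed.

Let localE n (G : cantor_space -> R) x : (forall x y, cylinder x n y -> G y = G x) ->
  G x = \sum_(s : n.-tuple bool) G (extend s) * \1_(cylinder (extend s) n) x.
Proof.
move=> Gn; rewrite (bigD1 (prefix n x))//= big1 => [|s sx].
  have xn : cylinder (extend (prefix n x)) n x by exact: extendK.
  by rewrite addr0 indicE (mem_set xn) mulr1; exact: Gn.
rewrite indicE memNset ?mulr0// => /extend_inj sE.
by rewrite sE eqxx in sx.
Qed.

Let l_sum (I : Type) (r : seq I) (a : I -> R) (A : I -> set cantor_space) :
  (forall i, 0 <= a i) ->
  bounded_fct (fun x => \sum_(i <- r) a i * \1_(A i) x) /\
  l (fun x => \sum_(i <- r) a i * \1_(A i) x) = \sum_(i <- r) a i * l (\1_(A i)).
Proof.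
move=> a0; elim: r => [|i r [[c bc] ih]].
  under eq_fun do rewrite big_nil.
  by rewrite big_nil lcst0; split => //; exact: bounded_cst.
under eq_fun do rewrite big_cons.
rewrite big_cons -ih -lZ//; split.
  exists (a i + c) => t; apply: (le_trans (ler_normD _ _)).
  rewrite lerD// normrM ger0_norm// -[leRHS]mulr1 ler_wpM2l//.
  by rewrite indicE; case: (_ \in _); rewrite ?normr0 ?normr1.
rewrite -lD//; last by exists c.
exists (a i) => t; rewrite /= normrM ger0_norm// -[leRHS]mulr1 ler_wpM2l//.
by rewrite indicE; case: (_ \in _); rewrite ?normr0 ?normr1.
Qed.

Let measurable_cylinder x n : measurable (cylinder x n : set cantor_borel).
Proof. by apply: sub_sigma_algebra; exact: clopen_cylinder. Qed.

Let local_measurable n (G : cantor_space -> R) :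
  (forall x y, cylinder x n y -> G y = G x) ->
  measurable_fun setT (G : cantor_borel -> R).
Proof.
move=> Gn; rewrite (_ : G = fun x => \sum_(s : n.-tuple bool)
    G (extend s) * \1_(cylinder (extend s) n) x); last first.
  by apply/funext => x; exact: localE.
apply: measurable_sum => s; apply: measurable_funM => //.
Qed.

(** A function of the first [n] coordinates is a finite combination of
    indicators of clopen sets, on which [l] and the measure agree. *)
Let integral_local n (G : cantor_space -> R) :
  (forall x y, cylinder x n y -> G y = G x) -> (forall x, 0 <= G x) ->
  bounded_fct G /\
  (\int[cantor_measure]_(x in setT) (G x)%:E = (l G)%:E)%E.
Proof.
move=> Gn G0; have GE : G = fun x => \sum_(s : n.-tuple bool)
    G (extend s) * \1_(cylinder (extend s) n) x.
  by apply/funext => x; exact: localE.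
have [bG lG] := @l_sum _ (index_enum (n.-tuple bool : finType)) (fun s => G (extend s))
  (fun s => cylinder (extend s) n) (fun s => G0 _).
split; first by rewrite GE.
rewrite [in RHS]GE lG.
transitivity (\int[cantor_measure]_(x in setT) \sum_(s : n.-tuple bool)
    ((G (extend s))%:E * (\1_(cylinder (extend s) n) x)%:E))%E.
  by apply: eq_integral => x _; rewrite {1}GE -sumEFin.
rewrite ge0_integral_sum//=; last first.
- by move=> s x _; rewrite mule_ge0 ?lee_fin.
- move=> s; apply: emeasurable_funM => //; apply/measurable_EFinP.
  exact: measurable_indic.
rewrite -sumEFin; apply: eq_bigr => s _.
rewrite ge0_integralZl_EFin//=; last first.
  by apply/measurable_EFinP; exact: measurable_indic.
rewrite integral_indic// setIT EFinM; congr (_ * _)%E.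
by apply: cantor_measure_clopen; exact: clopen_cylinder.
Qed.

(** [F] is the increasing limit of its infima over the cylinders of depth [n],
    truncated at the value [n] so as to be bounded; these are functions of [n]
    coordinates below [F]. *)
Lemma cantor_lsc (F : cantor_space -> R) : (forall x, 0 <= F x) ->
  (forall c, open [set x | c < F x]) ->
  measurable_fun setT (F : cantor_borel -> R) /\
  forall N, (forall f, bounded_fct f -> (forall x, f x <= F x) -> l f <= N) ->
  (\int[cantor_measure]_(x in setT) (F x)%:E <= N%:E)%E.
Proof.
move=> F0 oF.
pose G n x := Num.min n%:R (inf (F @` cylinder x n)).
have Ginf x n : has_inf (F @` cylinder x n).
  by split; [exists (F x), x|exists 0 => _ [y _ <-]].
have G_local n x y : cylinder x n y -> G n y = G n x.
  by move=> xy; rewrite /G (cylinderC xy).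
have G0 n x : 0 <= G n x.
  rewrite le_min ler0n/=; apply: lb_le_inf; first by have [] := Ginf x n.
  by move=> _ [y _ <-].
have GF n x : G n x <= F x.
  rewrite ge_min; apply/orP; right; apply: ge_inf; last by exists x.
  by have [] := Ginf x n.
have Gnd x : nondecreasing_seq (G ^~ x).
  move=> m n mn; rewrite /G le_min !ge_min ler_nat mn/=; apply/orP; right.
  apply: lb_le_inf; first by have [] := Ginf x n.
  move=> _ [y xy <-]; apply: ge_inf; first by have [] := Ginf x m.
  by exists y => //; exact: cylinder_le xy.
have Gcvg x : G n x @[n --> \oo] --> F x.
  apply/cvgrPdist_le => e e0.
  have [n0 n0F] := @cylinder_sub_open x _ (oF (F x - e)) ltac:(by rewrite /= gtrBl).
  near=> n; rewrite ger0_norm ?subr_ge0// lerBlDl -lerBlDr le_min; apply/andP; split.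
    apply: (@le_trans _ _ (F x)); first by rewrite gerBl ltW.
    by near: n; exact: nbhs_infty_ger.
  apply: lb_le_inf; first by have [] := Ginf x n.
  move=> _ [y xy <-]; apply/ltW; apply: n0F; apply: cylinder_le xy.
  by near: n; exact: nbhs_infty_ge.
have mG n : measurable_fun setT (G n : cantor_borel -> R).
  by apply: (@local_measurable n) => x y; exact: G_local.
split; first exact: (measurable_fun_cvg mG (fun x _ => Gcvg x)).
move=> N lFN.
have FE x : (F x)%:E = limn (fun n => (G n x)%:E).
  by apply/esym/cvg_lim => //; apply: cvg_EFin; [exact: nearW|exact: Gcvg].
under eq_integral do rewrite FE.
rewrite monotone_convergence//.
- apply: lime_le.
    apply: ereal_nondecreasing_is_cvgn => m n mn; apply: ge0_le_integral => //.
    + by move=> x _; rewrite lee_fin.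
    + exact/measurable_EFinP.
    + exact/measurable_EFinP.
    + by move=> x _; rewrite lee_fin Gnd.
  apply: nearW => n; have [bG ->] := @integral_local n (G n) (G_local n) (G0 n).
  by rewrite lee_fin; apply: lFN.
- by move=> n; exact/measurable_EFinP.
- by move=> n x _; rewrite lee_fin.
- by move=> x _ m n mn; rewrite lee_fin Gnd.
Unshelve. all: by end_near. Qed.

End cantor_measure.

(** * Probabilities on a compact set of curves *)

(** A subset as a topological space with a base point [x], since [cantor_surj]
    is about pointed spaces. *)
Definition pointed_subset (T : Type) (A : set T) (x : A) : Type := set_type A.

HB.instance Definition _ (R : realType) (T : pseudoMetricType R) (A : set T) (x : A) :=
  PseudoMetric.on (pointed_subset x).
HB.instance Definition _ (R : realType) (T : pseudoMetricType R) (A : set T) (x : A) :=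
  isPointed.Build (pointed_subset x) x.

(** Alexandroff-Hausdorff: every nonempty compact metric space is a continuous
    image of the Cantor space. *)
Lemma cantor_onto_compact (R : realType) (T : metricType R) (A : set T) :
  compact A -> A !=set0 ->
  exists g : cantor_space -> T, continuous g /\ range g = A.
Proof.
move=> cA [x Ax]; pose P := pointed_subset (exist _ x (mem_set Ax) : A).
have cP : compact [set: P].
  move=> F FF _; have [|y [Ay cly]] := cA (set_val @ F) _.
    by apply: (@filterS _ F _ setT) filterT => t _ /=; exact: set_mem (valP t).
  exists (exist _ y (mem_set Ay)); split=> // B U FB [_ [[V oV <-]] Vy VU].
  have FvB : (set_val @ F) (set_val @` B).
    by apply: (@filterS _ F _ B) FB => t Bt; exists t.
  have [_ [[t Bt <-] Vt]] := cly _ _ FvB (open_nbhs_nbhs (conj oV Vy)).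
  by exists t; split=> //; exact: VU.
have hP : hausdorff_space P.
  move=> p q pq; apply: val_inj; apply: (@metric_hausdorff R T) => U V Up Vq.
  have cv : continuous (set_val : A -> T) by exact: initial_continuous.
  have [] := pq (set_val @^-1` U) (set_val @^-1` V).
  - exact: (cv p).
  - exact: (cv q).
  by move=> z [Uz Vz]; exists (set_val z).
have [f cf] := cantor_surj cP hP.
exists (fun s => set_val (f s : A)); split.
  move=> s; apply: (@continuous_comp _ A _ f set_val); first exact: cf.
  exact: initial_continuous.
apply/seteqP; split => [_ [s _ <-]|y Ay]; first exact: set_mem (valP (f s)).
have [s _ fs] := @surj _ _ _ _ f (exist _ y (mem_set Ay)) I.
by exists s => //; rewrite fs.
Qed.

Lemma continuous_borel_measurable d (T : measurableType d)
  (Y : ptopologicalType) (f : T -> borel Y) :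
  (forall U : set Y, open U -> measurable (f @^-1` U)) -> measurable_fun setT f.
Proof.
move=> oU; apply: (@measurability _ _ T (borel Y) setT f (@open Y)) => //.
by move=> _ [U oU' <-]; rewrite setTI; exact: oU.
Qed.

Lemma borel_open (Y : ptopologicalType) (U : set Y) : open U ->
  measurable (U : set (borel Y)).
Proof. exact: sub_sigma_algebra. Qed.

Lemma borel_closed (Y : ptopologicalType) (U : set Y) : closed U ->
  measurable (U : set (borel Y)).
Proof.
by move=> cU; rewrite -[U]setCK; apply: measurableC; apply: borel_open; exact: closed_openC.
Qed.

Section relative_lower_semicontinuity.
Variables (T : topologicalType) (R : realType) (A : set T).
Implicit Types F G : T -> R.

(** Lower semicontinuity of the restriction of [F] to the subspace [A]. *)
Definition lsc_on F := forall c, exists2 U, open U & A `&` [set x | c < F x] = A `&` U.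

Lemma open_lsc_on F : (forall c, open [set x | c < F x]) -> lsc_on F.
Proof. by move=> oF c; exists [set x | c < F x]. Qed.

Lemma lsc_on_eq F G : (forall x, A x -> F x = G x) -> lsc_on F -> lsc_on G.
Proof.
move=> FG lF c; have [U oU UE] := lF c; exists U => //; rewrite -UE.
by apply/seteqP; split => x /= [Ax]; rewrite FG.
Qed.

(** [c < F + G] if and only if [r < F] and [c - r < G] for some [r]. *)
Lemma lsc_onD F G : lsc_on F -> lsc_on G -> lsc_on (F \+ G).
Proof.
have witness H : lsc_on H -> exists U, forall r : R,
    open (U r) /\ A `&` [set x | r < H x] = A `&` U r.
  move=> lH; suff /boolp.choice[U UP] : forall r, exists V,
      open V /\ A `&` [set x | r < H x] = A `&` V by exists U.
  by move=> r; have [U oU UE] := lH r; exists U.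
move=> /witness[U UP] /witness[V VP] c.
have FG1 x : A x -> forall r, r < F x <-> U r x.
  move=> Ax r; have [_ UE] := UP r; have := congr1 (@^~ x) UE => /= E.
  by split => h; [have [] : (A `&` U r) x by rewrite -UE
                 |have [] : (A `&` [set x | r < F x]) x by rewrite UE].
have FG2 x : A x -> forall r, r < G x <-> V r x.
  move=> Ax r; have [_ VE] := VP r.
  by split => h; [have [] : (A `&` V r) x by rewrite -VE
                 |have [] : (A `&` [set x | r < G x]) x by rewrite VE].
exists (\bigcup_(r in setT) (U r `&` V (c - r))).
  by apply: bigcup_open => r _; apply: openI; [have [] := UP r|have [] := VP (c - r)].
apply/seteqP; split => x /= [Ax].
  move=> cFG; split => //; exists ((F x + (c - G x)) / 2) => //.
  by split; [apply/(FG1 _ Ax)|apply/(FG2 _ Ax)]; lra.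
by move=> [r _ [/(FG1 _ Ax) rF /(FG2 _ Ax) rG]]; split => //; lra.
Qed.

Lemma lsc_onZ t F : 0 < t -> lsc_on F -> lsc_on (t \*o F).
Proof.
move=> t0 lF c; have [U oU UE] := lF (c / t); exists U => //; rewrite -UE.
by apply/seteqP; split => x /= [Ax]; rewrite ltr_pdivrMr// mulrC.
Qed.

End relative_lower_semicontinuity.

Lemma open_ltD (T : topologicalType) (R : realType) (F G : T -> R) :
  (forall c, open [set x | c < F x]) -> (forall c, open [set x | c < G x]) ->
  forall c, open [set x | c < F x + G x].
Proof.
move=> /(@open_lsc_on _ _ setT) lF /(@open_lsc_on _ _ setT) lG c.
by have [U oU] := lsc_onD lF lG c; rewrite !setTI => ->.
Qed.

Lemma open_indic (T : topologicalType) (R : realType) (U : set T) (c : R) :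
  open U -> open [set x | c < \1_U x].
Proof.
move=> oU; have [c0|c0] := ltP c 0.
  rewrite (_ : [set _ | _] = setT); first exact: openT.
  by apply/seteqP; split => // x _ /=; rewrite (lt_le_trans c0)// indicE.
have [c1|c1] := ltP c 1.
  rewrite (_ : [set _ | _] = U)//; apply/seteqP; split => x /=; rewrite indicE.
    by case: (boolP (x \in _)) => [/set_mem//|_]; rewrite ltNge c0.
  by move=> Ux; rewrite mem_set.
rewrite (_ : [set _ | _] = set0); first exact: open0.
apply/seteqP; split => // x /=; rewrite indicE ltNge => /negP; apply.
by apply: le_trans c1; case: (_ \in _).
Qed.
Section compact_measure.
Variables (R : realType) (X : completeMetricType R) (Gamma : set (curve X)).
Variable K : (curve X -> R) -> R -> Prop.
Hypotheses (Gamma_compact : compact Gamma) (Gamma0 : Gamma !=set0)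
  (K0 : K (cst 0) 0)
  (KD : forall F G M N, K F M -> K G N -> K (F \+ G) (M + N))
  (KZ : forall (t : R) F M, 0 < t -> K F M -> K (t \*o F) (t * M))
  (K_ge0 : forall F N g, K F N -> 0 <= F g)
  (K_lsc : forall F N, K F N -> lsc_on Gamma F)
  (K_measurable : forall F N, K F N -> measurable_fun setT (F : borel (curve X) -> R))
  (K_inf : forall F N e, K F N -> 0 < e -> exists2 g, Gamma g & F g <= N + e).

(** The minimax principle: if each constraint [(F, N)] of a convex cone of lower
    semicontinuous functions is satisfied, up to [e], at some curve, then one
    probability satisfies all of them. It is the image of the measure of the
    mean under a parametrization [g] of [Gamma] by the Cantor space, where
    [F \o g] is lower semicontinuous. *)
Lemma compact_measure : exists pi : probability (borel (curve X)) R,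
  pi Gamma = 1%E /\ forall F N, K F N -> (\int[pi]_g (F g)%:E <= N%:E)%E.
Proof.
have [g [cg gE]] := cantor_onto_compact Gamma_compact Gamma0.
have gG s : Gamma (g s) by rewrite -gE; exists s.
pose Kg f N := exists2 F, K F N & f = F \o g.
have [] := @mean_minorant R cantor_space Kg.
- by exists (cst 0).
- move=> _ _ M N [F KF ->] [G KG ->]; exists (F \+ G) => //; exact: KD.
- move=> t _ M t0 [F KF ->]; exists (t \*o F) => //; exact: KZ.
- move=> _ N e [F KF ->] e0; have [h] := K_inf KF e0.
  by rewrite -gE => -[s _ <-]; exists s.
move=> l [lD lZ l_le lK].
pose nu := cantor_measure lD lZ l_le.
have mg : measurable_fun setT
    (g : g_sigma_algebraType (@measurable clopen_display clopen_space) -> borel (curve X)).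
  apply: continuous_borel_measurable => U oU.
  have [||mU _] := cantor_lsc lD lZ l_le (F := \1_(g @^-1` U)).
  - by move=> x; rewrite indicE.
  - move=> c; apply: open_indic.
    by apply: open_comp => // x _; exact: cg.
  have := mU measurableT [set 1] (measurable_set1 _); rewrite setTI.
  congr measurable; apply/seteqP; split => x /=; rewrite indicE.
    by case: (boolP (x \in _)) => [/set_mem//|_] /eqP; rewrite eq_sym oner_eq0.
  by move=> Ux; rewrite mem_set.
pose pi := distribution nu (mfun_Sub (mem_set mg)).
exists pi; split.
  rewrite -(@probability_setT _ _ _ nu) /pi /distribution /pushforward.
  by congr (nu _); apply/seteqP; split => s _ //=; exact: gG.
move=> F N KF; rewrite ge0_integral_distribution//.
- have [||_] := cantor_lsc lD lZ l_le (F := F \o g).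
  + by move=> s; exact: K_ge0 KF.
  + move=> c; have [U oU GU] := K_lsc KF c.
    rewrite (_ : [set _ | _] = g @^-1` U).
      by apply: open_comp => // x _; exact: cg.
    apply/seteqP; split => s /= h.
      by have [] : (Gamma `&` U) (g s) by rewrite -GU; split.
    by have [] : (Gamma `&` [set g | c < F g]) (g s) by rewrite GU; split.
  apply=> f bf fF; apply: (lK f _ N bf _ fF); by exists F.
- by apply/measurable_EFinP; exact: K_measurable KF.
- by move=> y; rewrite lee_fin; exact: K_ge0 KF.
Qed.

End compact_measure.

(** * Length of a curve inside a set *)
Lemma ereal_supD_le (R : realType) (A B : set R) (z : \bar R) :
  (exists x, A x) -> (forall x y, A x -> B y -> ((x + y)%:E <= z)%E) ->
  (ereal_sup (EFin @` A) + ereal_sup (EFin @` B) <= z)%E.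
Proof.
move=> [x0 Ax0] ABz.
have xB x : A x -> (x%:E + ereal_sup (EFin @` B) <= z)%E.
  move=> Ax; rewrite -leeBrDl//; apply: ge_ereal_sup => _ [y By <-].
  by rewrite leeBrDl// -EFinD; exact: ABz.
move: xB; case: (ereal_sup (EFin @` B)) => [b| |] xB.
- rewrite -leeBrDr//; apply: ge_ereal_sup => _ [x Ax <-].
  by rewrite leeBrDr//; exact: xB.
- by have := xB _ Ax0; rewrite addey// => /(le_trans _); apply; rewrite leey.
- by rewrite addeNy leNye.
Qed.

Section partitions.
Variables (R : realType) (X : completeMetricType R).
Implicit Types (g : curve X) (U : set X) (a b c x y t : unitI R) (s : seq (unitI R)).

Definition partition a b s := itv_partition (\val a) (\val b) (map \val s).

Lemma partition_nil a b : partition a b [::] -> a = b.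
Proof. by move=> /itv_partition_nil; exact: val_inj. Qed.

Lemma partition_cons a b x s :
  partition a b (x :: s) <-> \val a < \val x /\ partition x b s.
Proof.
rewrite /partition /itv_partition /=; split.
  by move=> [/andP[]].
by move=> [-> [-> ->]].
Qed.

Lemma partition_le a b s : partition a b s -> \val a <= \val b.
Proof. exact: itv_partition_le. Qed.

Lemma partition_cat a b c s1 s2 :
  partition a b s1 -> partition b c s2 -> partition a c (s1 ++ s2).
Proof. by rewrite /partition map_cat; exact: itv_partition_cat. Qed.

Lemma partition_ex a b : \val a <= \val b -> exists s, partition a b s.
Proof.
rewrite le_eqVlt => /predU1P[/val_inj ->|ab]; first by exists [::]; split.
by exists [:: b]; exact: itv_partition1.
Qed.

Definition maps_into g U a b := forall t, \val a <= \val t <= \val b -> U (g t).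

(** Only the arcs that [g] maps entirely into [U] count, which makes this a
    lower semicontinuous function of [g] when [U] is open. *)
Fixpoint partial_length g U a s : R :=
  if s is x :: s' then
    (if `[< maps_into g U a x >] then mdist (g a) (g x) else 0) +
    partial_length g U x s'
  else 0.

Lemma partial_length_ge0 g U a s : 0 <= partial_length g U a s.
Proof.
by elim: s a => //= x s ih a; rewrite addr_ge0//; case: ifP => // _; exact: mdist_ge0.
Qed.

Lemma partial_length_cat g U a s1 s2 : partial_length g U a (s1 ++ s2) =
  partial_length g U a s1 + partial_length g U (last a s1) s2.
Proof. by elim: s1 a => [|x s1 ih] a /=; rewrite ?add0r// ih addrA. Qed.

Lemma partition_last a b s : partition a b s -> last a s = b.
Proof. by move=> [_]; rewrite last_map => /eqP /val_inj. Qed.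

Definition length_in g U a b : \bar R :=
  ereal_sup (EFin @` (partial_length g U a @` partition a b)).

Lemma length_in_ge g U a b s : partition a b s ->
  ((partial_length g U a s)%:E <= length_in g U a b)%E.
Proof.
by move=> abs; apply: ereal_sup_ubound; exists (partial_length g U a s) => //; exists s.
Qed.

Lemma length_in_le g U a b z :
  (forall s, partition a b s -> ((partial_length g U a s)%:E <= z)%E) ->
  (length_in g U a b <= z)%E.
Proof. by move=> h; apply: ge_ereal_sup => _ [_ [s abs <-] <-]; exact: h. Qed.

Lemma length_in_ge0 g U a b : \val a <= \val b -> (0 <= length_in g U a b)%E.
Proof.
move=> /partition_ex[s abs]; apply: le_trans (length_in_ge g U abs).
by rewrite lee_fin partial_length_ge0.
Qed.

Lemma length_in_superadditive g U a b c : \val a <= \val b ->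
  (length_in g U a b + length_in g U b c <= length_in g U a c)%E.
Proof.
move=> /partition_ex[s0 abs0]; apply: ereal_supD_le.
  by exists (partial_length g U a s0); exists s0.
move=> _ _ [s1 s1P <-] [s2 s2P <-].
rewrite -(partition_last s1P) -partial_length_cat.
exact/length_in_ge/(partition_cat s1P).
Qed.

Lemma curve_lengthE g a b : curve_length g a b = length_in g setT a b.
Proof.
have plE s : forall a, partial_length g setT a s =
    \sum_(0 <= i < size s) mdist (g (nth b (a :: s) i)) (g (nth b (a :: s) i.+1)).
  elim: s => [|x s ih] a' /=; first by rewrite big_nil.
  rewrite big_nat_recl//= ih; congr (_ + _).
  by rewrite asboolT.
rewrite /curve_length /length_in; congr ereal_sup; apply/seteqP; split.
  by move=> _ [s sP <-]; exists (partial_length g setT a s); [exists s|rewrite plE].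
by move=> _ [_ [s sP <-] <-]; exists s => //; rewrite plE.
Qed.

Lemma maps_into_length g U a b : maps_into g U a b -> \val a <= \val b ->
  length_in g U a b = curve_length g a b.
Proof.
move=> gU ab; rewrite curve_lengthE /length_in; congr (ereal_sup (EFin @` _)).
have plE s : forall a, maps_into g U a b -> partition a b s ->
    partial_length g U a s = partial_length g setT a s.
  elim: s => //= x s ih a' a'U /partition_cons[ax xs].
  have xb := partition_le xs.
  rewrite !asboolT//; last first.
    by move=> t /andP[a't tx]; apply: a'U; rewrite a't (le_trans tx).
  by rewrite ih// => t /andP[xt tb]; apply: a'U; rewrite tb (le_trans (ltW ax)).
apply/seteqP; split => _ [s sP <-]; exists s => //; rewrite plE//.
Qed.

Lemma curve_lengthxx g a : curve_length g a a = 0%E.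
Proof.
rewrite curve_lengthE; apply/eqP; rewrite eq_le length_in_ge0// andbT.
apply: length_in_le => s /itv_partitionxx.
by case: s.
Qed.

Lemma mdist_le_length g a b : \val a <= \val b ->
  ((mdist (g a) (g b))%:E <= curve_length g a b)%E.
Proof.
rewrite le_eqVlt => /predU1P[/val_inj ->|ab]; first by rewrite curve_lengthxx mdistxx.
have := @length_in_ge g setT a b [:: b] (itv_partition1 ab).
by rewrite curve_lengthE /= addr0 asboolT.
Qed.

Lemma curve_length_ge0 g a b : \val a <= \val b -> (0 <= curve_length g a b)%E.
Proof. by rewrite curve_lengthE; exact: length_in_ge0. Qed.

(** Only [<=] needs work: in a partition of [[a, c]], the arc that contains [b]
    is cut at [b], which does not decrease the sum. *)
Lemma curve_lengthD g a b c : \val a <= \val b -> \val b <= \val c ->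
  curve_length g a c = (curve_length g a b + curve_length g b c)%E.
Proof.
move=> ab bc; apply/eqP; rewrite eq_le; apply/andP; split; last first.
  by rewrite !curve_lengthE; exact: length_in_superadditive.
rewrite [leLHS]curve_lengthE; apply: length_in_le => s.
elim: s a ab => [|x s ih] a ab.
  by move=> _; rewrite /= adde_ge0// curve_length_ge0.
move=> /partition_cons[ax xs] /=; rewrite asboolT// EFinD.
have xc := partition_le xs.
have [xb|bx] := leP (\val x) (\val b).
  apply: (@le_trans _ _ (curve_length g a x + (curve_length g x b + curve_length g b c))%E).
    by rewrite leeD ?ih// mdist_le_length// ltW.
  rewrite addeA leeD2r// !curve_lengthE; apply: length_in_superadditive.
  exact: ltW.
apply: (@le_trans _ _
  ((mdist (g a) (g b))%:E + ((mdist (g b) (g x))%:E + curve_length g x c))%E).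
  rewrite addeA; apply: leeD; first by rewrite -EFinD lee_fin metric_triangle.
  by rewrite curve_lengthE length_in_ge.
rewrite leeD ?mdist_le_length//.
apply: (@le_trans _ _ (curve_length g b x + curve_length g x c)%E).
  by rewrite leeD2r// mdist_le_length// ltW.
by rewrite !curve_lengthE; apply: length_in_superadditive; exact: ltW.
Qed.

Lemma unitI_ge0 t : 0 <= \val t.
Proof. by have := set_mem (valP t); rewrite /= in_itv/= => /andP[]. Qed.

Lemma unitI_le1 t : \val t <= 1.
Proof. by have := set_mem (valP t); rewrite /= in_itv/= => /andP[]. Qed.

Lemma curve_length_fin g a b : rectifiable g -> \val a <= \val b ->
  curve_length g a b \is a fin_num.
Proof.
move=> rg ab; rewrite ge0_fin_numE ?curve_length_ge0//; apply: le_lt_trans rg.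
rewrite (@curve_lengthD g (I0 R) a (I1 R)) ?unitI_ge0 ?unitI_le1//.
rewrite (@curve_lengthD g a b (I1 R)) ?unitI_le1//.
apply: (@le_trans _ _ (curve_length g a b + curve_length g b (I1 R))%E).
  by rewrite leeDl// curve_length_ge0 ?unitI_le1.
by rewrite leeDr// curve_length_ge0 ?unitI_ge0.
Qed.

Lemma curve_continuous_near g t e : 0 < e ->
  exists2 d, 0 < d & forall x, `|\val x - \val t| < d -> mdist (g t) (g x) < e.
Proof.
move=> e0; have /metricType_numDomainType.cvgrPdist_lt /(_ e e0) := @cts_fun _ _ g t.
move=> [_ [[V oV <-] Vt VU]].
have /nbhs_ballP[d /= d0 dV] : nbhs (\val t) V by exact: open_nbhs_nbhs.
exists d => // x xt; apply: VU; apply: dV.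
by rewrite /ball/= distrC.
Qed.

Lemma unitI_itv (r : R) : 0 <= r -> r <= 1 -> {x : unitI R | \val x = r}.
Proof.
move=> r0 r1; have h : r \in (`[0, 1]%classic : set R) by rewrite inE /= in_itv/= r0.
by exists (exist _ r h).
Qed.

(** The length of a rectifiable curve does not jump at [t]: take a partition of
    [[t, 1]] whose sum is within [e / 2] of the length, and insert a point [t']
    with [mdist (g t) (g t') < e / 2]. The rest of the sum is at most the length
    over [[t', 1]], which leaves at most [e] for [[t, t']]. *)
Lemma length_right g t e : rectifiable g -> \val t < 1 -> 0 < e ->
  exists2 t', \val t < \val t' & (curve_length g t t' <= e%:E)%E.
Proof.
move=> rg t1 e0.
have lfin : curve_length g t (I1 R) \is a fin_num.
  by apply: curve_length_fin => //; exact: unitI_le1.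
have e20 : 0 < e / 2 by rewrite divr_gt0.
have [_ [_ [s sP <-] <-]] := @ub_ereal_sup_adherent R
  (EFin @` (partial_length g setT t @` partition t (I1 R))) (e / 2) e20
  ltac:(by move: lfin; rewrite curve_lengthE).
rewrite -/(length_in _ _ _ _) -curve_lengthE.
case: s sP => [/partition_nil tE|x s /partition_cons[tx xs]]; first by rewrite tE ltxx in t1.
have [d d0 dt] := curve_continuous_near g t e20.
pose r := \val t + Num.min (d / 2) ((\val x - \val t) / 2).
have m0 : 0 < Num.min (d / 2) ((\val x - \val t) / 2).
  by rewrite lt_min !divr_gt0// subr_gt0.
have tr : \val t < r by rewrite ltrDl.
have rx : r < \val x.
  have : Num.min (d / 2) ((\val x - \val t) / 2) <= (\val x - \val t) / 2.
    by rewrite ge_min lexx orbT.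
  by rewrite /r; lra.
have rd : r - \val t < d.
  have : Num.min (d / 2) ((\val x - \val t) / 2) <= d / 2 by rewrite ge_min lexx.
  by rewrite /r; lra.
have [t' t'E] := @unitI_itv r
  (le_trans (unitI_ge0 t) (ltW tr)) (le_trans (ltW rx) (unitI_le1 x)).
rewrite -t'E in tr rx rd.
move=> h; exists t' => //.
have tt' := @curve_lengthD g t t' (I1 R) (ltW tr) (unitI_le1 t').
have f1 := curve_length_fin rg (ltW tr).
have f2 : curve_length g t' (I1 R) \is a fin_num.
  by apply: curve_length_fin => //; exact: unitI_le1.
have gtt' : mdist (g t) (g t') < e / 2.
  by apply: dt; rewrite ger0_norm ?subr_ge0// ltW.
have h2 : ((partial_length g setT t (x :: s))%:E <=
    (e / 2)%:E + curve_length g t' (I1 R))%E.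
  rewrite /= asboolT//.
  apply: (@le_trans _ _ ((mdist (g t) (g t') )%:E +
      ((mdist (g t') (g x))%:E + (partial_length g setT x s)%:E))%E).
    by rewrite -!EFinD lee_fin addrA lerD2r metric_triangle.
  apply: leeD; first by rewrite lee_fin ltW.
  apply: (@le_trans _ _ (curve_length g t' x + curve_length g x (I1 R))%E).
    apply: leeD; first by rewrite mdist_le_length// ltW.
    by rewrite curve_lengthE length_in_ge.
  by rewrite -(@curve_lengthD g t' x (I1 R)) ?(partition_le xs) ?(ltW rx).
have := lt_le_trans h h2; rewrite tt'.
rewrite -(fineK f1) -(fineK f2) -!EFinD lte_fin lee_fin; lra.
Qed.

Lemma length_left g t e : rectifiable g -> 0 < \val t -> 0 < e ->
  exists2 t', \val t' < \val t & (curve_length g t' t <= e%:E)%E.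
Proof.
move=> rg t1 e0.
have lfin : curve_length g (I0 R) t \is a fin_num.
  by apply: curve_length_fin => //; exact: unitI_ge0.
have e20 : 0 < e / 2 by rewrite divr_gt0.
have [_ [_ [s sP <-] <-]] := @ub_ereal_sup_adherent R
  (EFin @` (partial_length g setT (I0 R) @` partition (I0 R) t)) (e / 2) e20
  ltac:(by move: lfin; rewrite curve_lengthE).
rewrite -/(length_in _ _ _ _) -curve_lengthE.
case/lastP: s sP => [/partition_nil tE|s y sP]; first by rewrite -tE ltxx in t1.
have yE : y = t by have := partition_last sP; rewrite last_rcons.
rewrite {}yE in sP *.
pose x := last (I0 R) s.
have [xt xs] : \val x < \val t /\ partition (I0 R) x s.
  move: sP => [+ _]; rewrite map_rcons rcons_path last_map => /andP[ps xt].
  by split => //; split => //; rewrite last_map.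
have [d d0 dt] := curve_continuous_near g t e20.
pose r := \val t - Num.min (d / 2) ((\val t - \val x) / 2).
have m0 : 0 < Num.min (d / 2) ((\val t - \val x) / 2).
  by rewrite lt_min !divr_gt0// subr_gt0.
have tr : r < \val t by rewrite gtrBl.
have rx : \val x < r.
  have : Num.min (d / 2) ((\val t - \val x) / 2) <= (\val t - \val x) / 2.
    by rewrite ge_min lexx orbT.
  by rewrite /r; lra.
have rd : \val t - r < d.
  have : Num.min (d / 2) ((\val t - \val x) / 2) <= d / 2 by rewrite ge_min lexx.
  by rewrite /r; lra.
have [t' t'E] := @unitI_itv r
  (le_trans (unitI_ge0 x) (ltW rx)) (le_trans (ltW tr) (unitI_le1 t)).
rewrite -t'E in tr rx rd.
move=> h; exists t' => //.
have tt' := @curve_lengthD g (I0 R) t' t (unitI_ge0 t') (ltW tr).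
have f1 := curve_length_fin rg (ltW tr).
have f2 : curve_length g (I0 R) t' \is a fin_num.
  by apply: curve_length_fin => //; exact: unitI_ge0.
have gtt' : mdist (g t) (g t') < e / 2.
  by apply: dt; rewrite distrC ger0_norm ?subr_ge0// ltW.
have h2 : ((partial_length g setT (I0 R) (rcons s t))%:E <=
    curve_length g (I0 R) t' + (e / 2)%:E)%E.
  rewrite -cats1 partial_length_cat /= asboolT// addr0.
  apply: (@le_trans _ _ ((partial_length g setT (I0 R) s)%:E + (mdist (g x) (g t'))%:E +
      (mdist (g t') (g t))%:E)%E).
    by rewrite -!EFinD lee_fin -addrA lerD2l metric_triangle.
  apply: leeD; last by rewrite metric_sym lee_fin ltW.
  rewrite (@curve_lengthD g (I0 R) x t') ?unitI_ge0 ?(ltW rx)//.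
  apply: leeD; last by rewrite mdist_le_length// ltW.
  by rewrite curve_lengthE length_in_ge.
have := lt_le_trans h h2; rewrite tt'.
rewrite -(fineK f1) -(fineK f2) -!EFinD lte_fin lee_fin; lra.
Qed.

End partitions.

(** * Existence of the length measure *)
Section length_measure_existence.
Variables (R : realType) (X : completeMetricType R).
Implicit Types (g : curve X) (a b c x y t : unitI R).

Let clamp_ge0 (r : R) : 0 <= Num.min (Num.max r 0) 1.
Proof. by rewrite le_min le_max lexx orbT ler01. Qed.

Let clamp_le1 (r : R) : Num.min (Num.max r 0) 1 <= 1.
Proof. by rewrite ge_min lexx orbT. Qed.

(** Retraction of the line onto the unit interval: it extends the length
    function to the line, and carries a measure on the line back to [unitI R]. *)
Definition clamp (r : R) : unitI R := sval (unitI_itv (clamp_ge0 r) (clamp_le1 r)).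

Lemma clampE (r : R) : \val (clamp r) = Num.min (Num.max r 0) 1.
Proof. exact: (svalP (unitI_itv (clamp_ge0 r) (clamp_le1 r))). Qed.

Lemma clampK t : clamp (\val t) = t.
Proof.
apply: val_inj; rewrite clampE max_l ?unitI_ge0// min_l//; exact: unitI_le1.
Qed.

Lemma clamp_id (r : R) : 0 <= r <= 1 -> \val (clamp r) = r.
Proof. by move=> /andP[r0 r1]; rewrite clampE max_l// min_l. Qed.

Lemma clamp_le (r s : R) : r <= s -> \val (clamp r) <= \val (clamp s).
Proof.
move=> rs; rewrite !clampE le_min ge_min; apply/andP; split; last by rewrite ge_min lexx orbT.
by rewrite ge_max !le_max rs lexx orbT.
Qed.

Lemma clamp_measurable : measurable_fun setT (clamp : measurableTypeR R -> borel (unitI R)).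
Proof.
apply: continuous_borel_measurable => U [V oV VU].
have -> : clamp @^-1` U = (fun r : R => Num.min (Num.max r 0) 1) @^-1` V.
  by rewrite -VU; apply/seteqP; split => r /=; rewrite -clampE.
have mf : measurable_fun setT (fun r : R => Num.min (Num.max r 0) 1).
  by apply: measurable_minr => //; exact: measurable_maxr.
by rewrite -[X in measurable X]setTI; apply: mf => //; exact: open_measurable.
Qed.

Definition length_fun g (rg : rectifiable g) (r : R) : R :=
  fine (curve_length g (I0 R) (clamp r)).

Lemma length_fun_sub g (rg : rectifiable g) (r s : R) : r <= s ->
  curve_length g (clamp r) (clamp s) = (length_fun rg s - length_fun rg r)%:E.
Proof.
move=> rs; have crs := clamp_le rs.
rewrite EFinB /length_fun !fineK ?curve_length_fin ?unitI_ge0//.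
rewrite (@curve_lengthD _ _ g (I0 R) (clamp r) (clamp s)) ?unitI_ge0// addeAC subee ?add0e//.
by rewrite curve_length_fin ?unitI_ge0.
Qed.

Lemma length_fun_nondecreasing g (rg : rectifiable g) : nondecreasing (length_fun rg).
Proof.
move=> r s rs; rewrite -subr_ge0 -lee_fin -length_fun_sub//.
exact/curve_length_ge0/clamp_le.
Qed.

Lemma length_fun_right_continuous g (rg : rectifiable g) :
  right_continuous (length_fun rg).
Proof.
move=> r; apply/cvgrPdist_le => e e0.
have [r1|r1] := leP 1 r.
  near=> s; have rs : r <= s by [].
  have -> : length_fun rg s = length_fun rg r.
    congr (fine (curve_length _ _ _)); apply: val_inj; rewrite !clampE.
    by rewrite !min_r// le_max ?r1// (le_trans r1 rs).
  by rewrite subrr normr0 ltW.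
have [|t' rt' lt'] := @length_right _ _ g (clamp r) e rg _ e0.
  by rewrite clampE gt_min gt_max r1 ltr01.
have rt : r < \val t'.
  by apply: le_lt_trans rt'; rewrite clampE le_min le_max lexx/= ltW.
near=> s.
have rs : r <= s by [].
have st : s <= \val t' by near: s; apply: nbhs_right_le.
rewrite distrC ger0_norm; last by rewrite subr_ge0 length_fun_nondecreasing.
rewrite -lee_fin -length_fun_sub//; apply: le_trans lt'.
rewrite (@curve_lengthD _ _ g (clamp r) (clamp s) t') ?clamp_le//.
  by rewrite leeDl// curve_length_ge0// -(clampK t') clamp_le.
by rewrite -[in leRHS](clampK t') clamp_le.
Unshelve. all: by end_near. Qed.

HB.instance Definition _ g (rg : rectifiable g) := isCumulative.Build R _ R
  (length_fun rg) (@length_fun_nondecreasing g rg)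
  (@length_fun_right_continuous g rg).

Lemma lebesgue_stieltjes_itv_oc (f : cumulative R R) (a b : R) : a <= b ->
  lebesgue_stieltjes_measure f `]a, b]%classic = (f b - f a)%:E.
Proof.
move=> ab; rewrite /lebesgue_stieltjes_measure /measure_extension/= measurable_mu_extE/=.
  exact: wlength_itv_bnd.
exact: is_ocitv.
Qed.

(** The Stieltjes measure is given on half-open intervals; the closed one has
    the same mass because the length function is also left-continuous
    ([length_left]). *)
Lemma lebesgue_stieltjes_length g (rg : rectifiable g) a b : \val a <= \val b ->
  lebesgue_stieltjes_measure (length_fun rg) `[\val a, \val b]%classic =
  curve_length g a b.
Proof.
move=> ab; have abE := length_fun_sub rg ab; rewrite !clampK in abE.
apply/eqP; rewrite eq_le; apply/andP; split; last first.
  rewrite abE -lebesgue_stieltjes_itv_oc//; apply: le_measure; rewrite ?inE//.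
  by apply: subset_itvr; rewrite bnd_simp.
apply/lee_addgt0Pr => e e0.
have [r ra Fr] : exists2 r, r < \val a & length_fun rg (\val a) - length_fun rg r <= e.
  have := unitI_ge0 a; rewrite le_eqVlt => /predU1P[a0|a0].
    (* The length function is constant on the negative half-line. *)
    exists (-1); first by rewrite -a0 ltrN10.
    rewrite (_ : length_fun rg (-1) = length_fun rg (\val a)) ?subrr ?ltW//.
    rewrite -a0 /length_fun; congr (fine (curve_length _ _ _)); apply: val_inj.
    by rewrite !clampE maxxx max_r ?lerN10.
  have [t' ta lt'] := length_left rg a0 e0.
  exists (\val t') => //; rewrite -lee_fin -length_fun_sub ?(ltW ta)//.
  by rewrite !clampK.
apply: (@le_trans _ _ (lebesgue_stieltjes_measure (length_fun rg) `]r, \val b]%classic)).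
  apply: le_measure; rewrite ?inE//.
  by move=> t /=; rewrite !in_itv/= => /andP[at' ->]; rewrite (lt_le_trans ra).
rewrite lebesgue_stieltjes_itv_oc ?(le_trans (ltW ra))//.
rewrite -[leLHS]/((length_fun rg (\val b) - length_fun rg r)%:E).
by rewrite abE -EFinD lee_fin; lra.
Qed.

Lemma length_measure_ex g : rectifiable g ->
  exists s : {measure set (borel (unitI R)) -> \bar R}, is_length_measure g s.
Proof.
move=> rg; have mD : measurable (`[0, 1]%classic : set (measurableTypeR R)) by [].
exists (measure_function_pushforward__canonical__measure_function_Measure
  (mrestr (lebesgue_stieltjes_measure (length_fun rg)) mD) clamp_measurable).
split => // a b ab; rewrite -(lebesgue_stieltjes_length rg ab)/= /pushforward /mrestr.
congr (lebesgue_stieltjes_measure _ _); apply/seteqP; split => r /=; rewrite !in_itv/=.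
  by move=> [+ r01]; rewrite clamp_id.
move=> /andP[ar rb].
have r01 : 0 <= r <= 1 by rewrite (le_trans (unitI_ge0 a))// (le_trans rb)// unitI_le1.
by rewrite clamp_id// ar rb.
Qed.

Lemma length_measureP g : rectifiable g -> is_length_measure g (length_measure g).
Proof.
move=> /length_measure_ex h; rewrite /length_measure; case: pselect => // e.
exact: projT2 (cid e).
Qed.

Lemma length_measureNrect g : ~ rectifiable g -> length_measure g = mzero.
Proof. by move=> Nrg; rewrite /length_measure; case: pselect => // -[s [rg]]. Qed.

Lemma length_measure_itv g a b : rectifiable g -> \val a <= \val b ->
  length_measure g [set t : borel (unitI R) | \val a <= \val (t : unitI R) <= \val b] =
  curve_length g a b.
Proof. by move=> /length_measureP[_]; exact. Qed.

End length_measure_existence.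

(** * The length measure of a preimage depends lower semicontinuously on the curve *)
Section length_inside_open.
Variables (R : realType) (X : completeMetricType R).
Implicit Types (g h : curve X) (U : set X) (a b x y t : unitI R).

Definition segment a b : set (borel (unitI R)) :=
  [set t : borel (unitI R) | \val a <= \val (t : unitI R) <= \val b].

Lemma segment_closed a b : closed (segment a b : set (unitI R)).
Proof.
have -> : (segment a b : set (unitI R)) = set_val @^-1` (`[\val a, \val b]%classic : set R).
  by apply/seteqP; split => t; rewrite /segment /= in_itv.
apply: closed_comp; last exact: itv_closed.
by move=> t _; exact: initial_continuous.
Qed.

Lemma segment_measurable a b : measurable (segment a b).
Proof. exact: (@borel_closed (unitI R) _ (@segment_closed a b)). Qed.

Lemma curve_continuous g : continuous (g : unitI R -> X).
Proof. exact: cts_fun. Qed.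

Lemma curve_measurable g : measurable_fun setT (g : borel (unitI R) -> borel X).
Proof.
apply: continuous_borel_measurable => U oU; apply: borel_open.
by apply: open_comp => // t _; exact: curve_continuous.
Qed.

Definition path_measure g : {measure set (borel X) -> \bar R} :=
  measure_function_pushforward__canonical__measure_function_Measure
    (length_measure g) (curve_measurable g).

Lemma path_measureE g A : path_measure g A =
  pushforward (length_measure g) (g : borel (unitI R) -> borel X) A.
Proof. by []. Qed.

Section rectifiable_curve.
Variables (g : curve X) (rg : rectifiable g).
Local Notation s := (length_measure g).

Let s_itv a b : \val a <= \val b -> s (segment a b) = curve_length g a b.
Proof. exact: length_measure_itv. Qed.

Let segmentT : segment (I0 R) (I1 R) = setT.
Proof. by apply/seteqP; split => // t _; rewrite /segment/= unitI_ge0 unitI_le1. Qed.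

Lemma length_measure_lty : (s setT < +oo)%E.
Proof. by rewrite -segmentT s_itv ?unitI_le1. Qed.

(** Superadditivity although the segments share [x]: points have no length. *)
Let segment_add a x b (W : set (borel (unitI R))) : measurable W ->
  \val a <= \val x -> \val x <= \val b ->
  (s (segment a x `&` W) + s (segment x b `&` W) <= s (segment a b `&` W))%E.
Proof.
move=> mW ax xb.
have mS c d : measurable (segment c d `&` W).
  by apply: measurableI => //; exact: segment_measurable.
have mx := segment_measurable x x.
have sx : s (segment x x) = 0%E by rewrite s_itv// curve_lengthxx.
have -> : s (segment x b `&` W) = s ((segment x b `&` W) `\` segment x x).
  rewrite -(measureU0 (measurableD (mS x b) mx) mx sx) -(measureU0 (mS x b) mx sx).
  congr (s _).
  by rewrite setDE setUIl setUCl setIT.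
rewrite -measureU//; last 2 first.
- exact: measurableD.
- apply/seteqP; split => // t; rewrite /segment/= => -[[/andP[_ tx] _] [[/andP[xt _] _]]].
  by apply; rewrite xt tx.
apply: le_measure; rewrite ?inE//; first by apply: measurableU => //; exact: measurableD.
move=> t; rewrite /segment /= => -[[/andP[at' tx] Wt]|[[/andP[xt tb] Wt] _]]; split => //.
  by rewrite at' (le_trans tx).
by rewrite tb (le_trans ax).
Qed.

Let preimage_open U : open U -> open (g @^-1` U).
Proof. by move=> oU; apply: open_comp => // t _; exact: curve_continuous. Qed.

Let length_in_le_measure U a b p : open U -> partition a b p ->
  ((partial_length g U a p)%:E <= s (segment a b `&` g @^-1` U))%E.
Proof.
move=> oU; have mW := borel_open (preimage_open oU).
elim: p a => [|x p ih] a; first by rewrite /= measure_ge0.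
move=> /partition_cons[/ltW ax xp] /=; have xb := partition_le xp.
apply: le_trans (segment_add mW ax xb); rewrite EFinD; apply: leeD; last exact: ih.
case: asboolP => [aU|_]; last exact: measure_ge0.
rewrite (_ : segment a x `&` _ = segment a x) ?s_itv ?mdist_le_length//.
by apply/seteqP; split => t; [case|move=> axt; split => //; exact: aU].
Qed.

(** The closed set of times whose [1/(n+1)]-neighbourhood is mapped into [U]; an
    arc shorter than [1/(n+1)] that meets it is mapped into [U] entirely. *)
Let well_inside U (n : nat) : set (borel (unitI R)) :=
  [set t : borel (unitI R) | forall y : unitI R,
    `|\val (t : unitI R) - \val y| < n.+1%:R^-1 -> U (g y)].

Let well_inside_closed U n : closed (well_inside U n : set (unitI R)).
Proof.
rewrite -[X in closed X]setCK; apply: open_closedC.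
have -> : ~` (well_inside U n : set (unitI R)) = \bigcup_(y in ~` (g @^-1` U))
    (set_val @^-1` (ball (\val y) n.+1%:R^-1 : set R)).
  apply/seteqP; split => t.
    move=> /existsNP[y /not_implyP[ty Uy]]; exists y => //=.
    by rewrite /ball/= distrC.
  by move=> [y Uy]; rewrite /= /ball/= distrC => ty /(_ y ty).
apply: bigcup_open => y _; apply: open_comp; last exact: ball_open.
by move=> t _; exact: initial_continuous.
Qed.

Let well_inside_cover U : open U -> g @^-1` U = \bigcup_n well_inside U n.
Proof.
move=> /preimage_open [V oV VE]; apply/seteqP; split => t; last first.
  by move=> [n _]; apply; rewrite subrr normr0 invr_gt0.
rewrite -{1}VE => /= Vt.
have /nbhs_ballP[d /= d0 dV] : nbhs (\val t) V by exact: open_nbhs_nbhs.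
have [n nd] : exists n, n.+1%:R^-1 < d.
  have [n] := ltr_add_invr (y := 0) (x := d) d0; rewrite add0r => nd.
  by exists n.
exists n => // y ty; have : (set_val @^-1` V) y by apply: dV; exact: lt_trans nd.
by rewrite VE.
Qed.

Let well_inside_le U m n : (m <= n)%N -> well_inside U m `<=` well_inside U n.
Proof.
move=> mn t h y ty; apply: h; apply: (lt_le_trans ty).
by rewrite lef_pV2 ?posrE// ler_nat ltnS.
Qed.

Let measure_well_inside U n : open U ->
  (s (well_inside U n) <= length_in g U (I0 R) (I1 R))%E.
Proof.
move=> oU; have mW := borel_closed (@well_inside_closed U n).
(* The uniform partition with step [1/(n+2) < 1/(n+1)]. *)
pose p k : unitI R := clamp (k%:R / n.+2%:R).
have pE k : (k <= n.+2)%N -> \val (p k) = k%:R / n.+2%:R.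
  by move=> kn; rewrite clamp_id// divr_ge0//= ler_pdivrMr// mul1r ler_nat.
have p0 : p 0%N = I0 R by apply: val_inj; rewrite pE// mul0r.
have p1 : p n.+2 = I1 R by apply: val_inj; rewrite pE// divff.
suff h k : (k <= n.+2)%N ->
    (s (segment (I0 R) (p k) `&` well_inside U n) <= length_in g U (I0 R) (p k))%E.
  by have := h n.+2 (leqnn _); rewrite p1 segmentT setTI.
elim: k => [_|k ih kn].
  rewrite p0; apply: (@le_trans _ _ (s (segment (I0 R) (I0 R)))).
    by apply: le_measure; rewrite ?inE//; [apply: measurableI => //|]; exact: segment_measurable.
  by rewrite s_itv// curve_lengthxx length_in_ge0.
have pk : \val (p k) = k%:R / n.+2%:R by rewrite pE// ltnW.
have pk1 : \val (p k.+1) = k%:R / n.+2%:R + n.+2%:R^-1.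
  by rewrite pE// -natr1 mulrDl mul1r.
have pkk : \val (p k) <= \val (p k.+1) by rewrite pk pk1 lerDl.
have I0p : \val (I0 R) <= \val (p k) by exact: unitI_ge0.
apply: (le_trans _ (length_in_superadditive g U (p k.+1) I0p)).
have mS c d : measurable (segment c d `&` well_inside U n).
  by apply: measurableI => //; exact: segment_measurable.
apply: (@le_trans _ _ (s ((segment (I0 R) (p k) `&` well_inside U n) `|`
    (segment (p k) (p k.+1) `&` well_inside U n)))).
  apply: le_measure; rewrite ?inE//; first exact: measurableU.
  move=> t [/andP[t0 tk] Wt]; have [tpk|pkt] := leP (\val (t : unitI R)) (\val (p k)).
    by left; split => //; rewrite /segment/= t0.
  by right; split => //; rewrite /segment/= tk ltW.
apply: (le_trans (measureU2 s (mS _ _) (mS _ _))); apply: leeD; first exact/ih/ltnW.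
have [[t [/andP[pt tp] Wt]]|empty] :=
    pselect (segment (p k) (p k.+1) `&` well_inside U n !=set0).
  have pU : maps_into g U (p k) (p k.+1).
    move=> y /andP[py yp]; apply: Wt.
    have dk : \val (p k.+1) - \val (p k) < n.+1%:R^-1.
      by rewrite pk pk1 addrAC subrr add0r ltf_pV2 ?posrE// ltr_nat.
    apply: le_lt_trans dk; move: pt tp py yp.
    move: (\val (p k)) (\val (p k.+1)) (\val (t : unitI R)) (\val y) => u v w z.
    by rewrite ler_norml; lra.
  rewrite (maps_into_length pU pkk) -s_itv//; apply: le_measure; rewrite ?inE//.
  exact: segment_measurable.
have -> : segment (p k) (p k.+1) `&` well_inside U n = set0.
  by apply/seteqP; split => // t ht; apply: empty; exists t.
by rewrite measure0 length_in_ge0.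
Qed.

(** Exhaust the preimage of [U] by the sets [well_inside U n]: each is covered
    by the arcs of a fine partition that [g] maps into [U]. *)
Lemma path_measure_open U : open U ->
  path_measure g U = length_in g U (I0 R) (I1 R).
Proof.
move=> oU; rewrite path_measureE /pushforward.
apply/eqP; rewrite eq_le; apply/andP; split; last first.
  rewrite -[g @^-1` U]setTI -segmentT; apply: length_in_le => p pP.
  exact: length_in_le_measure.
have WE := well_inside_cover oU.
have mW n := borel_closed (@well_inside_closed U n).
have := @nondecreasing_cvg_mu _ _ _ s (well_inside U) mW _ _.
rewrite -WE => /(_ (borel_open (preimage_open oU))) cv.
rewrite -(cvg_lim _ (cv _))//; last first.
  by move=> m n mn; apply/subsetPset; exact: well_inside_le.
apply: lime_le; last by apply: nearW => n; exact: measure_well_inside.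
by apply/cvg_ex; eexists; apply: cv => m n mn; apply/subsetPset; exact: well_inside_le.
Qed.

End rectifiable_curve.

Section lower_semicontinuity.

Lemma mdist_eval_le g h t : mdist (g t) (h t) <= mdist g h.
Proof. exact: mdist_sup_dist. Qed.

Lemma open_evaluation U t : open U -> open [set g : curve X | U (g t)].
Proof.
move=> oU; rewrite openE => g /= Ugt.
have /nbhs_ballP[e /= e0 eU] : nbhs (g t) U by exact: open_nbhs_nbhs.
apply/nbhs_ballP; exists e => // h; rewrite ballEmdist/= => gh.
by apply: eU; rewrite ballEmdist/=; exact: le_lt_trans (mdist_eval_le g h t) gh.
Qed.

(** The parameters range over a compact set, so a uniformly close curve still
    stays in [U] along the arc. *)
Lemma open_maps_into U a b : open U -> open [set g : curve X | maps_into g U a b].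
Proof.
move=> oU; rewrite openE => g /= gU.
have cS : compact (segment a b : set (unitI R)).
  by apply: (subclosed_compact (@segment_closed a b) (@unitI_compact R)).
have /compact_near_coveringP nS := cS.
have := nS _ (nbhs g) (fun h t => U (h t)) _ _.
apply => // t tab.
have /nbhs_ballP[e /= e0 eU] : nbhs (g t) U.
  by apply: open_nbhs_nbhs; split => //; exact: gU.
have e20 : 0 < e / 2 by rewrite divr_gt0.
have [d d0 dt] := curve_continuous_near g t e20.
exists ([set y : unitI R | `|\val y - \val t| < d], ball g (e / 2)) => /=.
  split; last exact: nbhsx_ballx.
  exists (set_val @^-1` (ball (\val t) d : set R)); split.
  - by exists (ball (\val t) d) => //; exact: ball_open.
  - by rewrite /= /ball/= subrr normr0.
  - by move=> y; rewrite /= /ball/= distrC.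
move=> [y h] /= [yt gh]; apply: eU; rewrite ballEmdist/=.
rewrite ballEmdist/= in gh.
have := metric_triangle (g t) (g y) (h y).
by have := mdist_eval_le g h y; have := dt _ yt; lra.
Qed.

Lemma open_partial_length U a p : open U ->
  forall c : R, open [set g : curve X | c < partial_length g U a p].
Proof.
move=> oU; elim: p a => [|x p ih] a.
  move=> c; have [c0|c0] := ltP c 0.
    rewrite (_ : [set _ | _] = setT); first exact: openT.
    by apply/seteqP; split.
  rewrite (_ : [set _ | _] = set0); first exact: open0.
  by apply/seteqP; split => // g /=; rewrite ltNge c0.
apply: open_ltD => //= c; have [c0|c0] := ltP c 0.
  rewrite (_ : [set _ | _] = setT); first exact: openT.
  apply/seteqP; split => // g _ /=; apply: (lt_le_trans c0).
  by case: ifP => // _; exact: mdist_ge0.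
rewrite (_ : [set _ | _] = [set g : curve X | maps_into g U a x] `&`
    [set g : curve X | c < mdist (g a) (g x)]); last first.
  apply/seteqP; split => g /=.
    by case: asboolP => // _; rewrite ltNge c0.
  by move=> [gU cg]; rewrite asboolT.
apply: openI; first exact: open_maps_into.
rewrite openE => g /= cg; apply/nbhs_ballP.
exists ((mdist (g a) (g x) - c) / 2); first by rewrite /= divr_gt0// subr_gt0.
move=> h; rewrite ballEmdist/= => gh.
have := mdist_eval_le g h a; have := mdist_eval_le g h x.
have := metric_triangle (g a) (h a) (g x).
have := metric_triangle (h a) (h x) (g x).
by rewrite (metric_sym (h x) (g x)); lra.
Qed.

Lemma open_length_in U a b (c : R) : open U ->
  open [set g : curve X | (c%:E < length_in g U a b)%E].
Proof.
move=> oU; rewrite (_ : [set _ | _] = \bigcup_(p in partition a b)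
    [set g : curve X | c < partial_length g U a p]).
  by apply: bigcup_open => p _; exact: open_partial_length.
apply/seteqP; split => g /=.
  by move=> /ereal_sup_gt[_ [_ [p pP <-] <-]]; rewrite lte_fin; exists p.
by move=> [p pP] /= cp; apply: lt_le_trans (length_in_ge g U pP); rewrite lte_fin.
Qed.

End lower_semicontinuity.

Lemma measurable_length_in U a b : open U ->
  measurable_fun setT (fun g : borel (curve X) => length_in (g : curve X) U a b).
Proof.
move=> oU; apply: (measurability _ (ErealGenOInfty.measurableE R)).
move=> _ [_ [r ->] <-]; rewrite setTI; apply: borel_open.
rewrite (_ : _ @^-1` _ = [set g : curve X | (r%:E < length_in g U a b)%E]).
  exact: open_length_in.
by apply/seteqP; split => g /=; rewrite in_itv/= andbT.
Qed.

Lemma rectifiable_measurable : measurable (@rectifiable R X : set (borel (curve X))).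
Proof.
have := measurable_length_in (I0 R) (I1 R) openT.
move=> /(_ measurableT [set x | (x < +oo)%E]); rewrite setTI.
rewrite (_ : _ @^-1` _ = @rectifiable R X); last first.
  by apply/seteqP; split => g /=; rewrite /rectifiable/= curve_lengthE.
by apply; rewrite -[X in measurable X]setTI; exact: emeasurable_fun_infty_o.
Qed.

Lemma path_measureNrect g A : ~ rectifiable g -> path_measure g A = 0%E.
Proof. by move=> Nrg; rewrite path_measureE /pushforward (length_measureNrect Nrg). Qed.

Lemma path_measure_lty g A : measurable A -> (path_measure g A < +oo)%E.
Proof.
move=> mA; have [rg|Nrg] := pselect (rectifiable g); last first.
  by rewrite path_measureNrect.
rewrite path_measureE /pushforward; apply: le_lt_trans (length_measure_lty rg).
apply: le_measure; rewrite ?inE//.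
by rewrite -[X in measurable X]setTI; exact: curve_measurable.
Qed.

(** The class of the sets [A] with this property is a Dynkin class, as the
    measures are finite, and it contains the open sets. *)
Lemma measurable_path_measure (A : set (borel X)) : measurable A ->
  measurable_fun setT (fun g : borel (curve X) => path_measure (g : curve X) A).
Proof.
have open_case (U : set X) : open U ->
    measurable_fun setT (fun g : borel (curve X) => path_measure (g : curve X) U).
  move=> oU.
  have -> : (fun g : borel (curve X) => path_measure (g : curve X) U) =
      (fun g : borel (curve X) => if `[< @rectifiable R X g >]
        then length_in (g : curve X) U (I0 R) (I1 R) else 0%E).
    apply/funext => g; case: asboolP => [rg|Nrg]; first exact: path_measure_open.
    by rewrite path_measureNrect.
  apply: measurable_fun_ifT => //; last exact: measurable_length_in.
  apply: (@measurable_fun_bool _ _ _ _ true).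
  rewrite setTI (_ : _ @^-1` _ = @rectifiable R X); first exact: rectifiable_measurable.
  by apply/seteqP; split => g /= /asboolP.
apply: (@dynkin_induction _ (borel X) (@open X)
  (fun A => measurable_fun setT (fun g : borel (curve X) => path_measure (g : curve X) A))) => //.
- exact: openI.
- exact: (open_case setT openT).
- move=> B mB mfB.
  rewrite (_ : (fun _ => _) = (fun g : borel (curve X) => path_measure (g : curve X) setT -
      path_measure (g : curve X) B)%E).
    by apply: emeasurable_funB => //; exact: (open_case setT openT).
  apply/funext => g; rewrite -setTD measureD//; last exact: path_measure_lty.
  by rewrite setTI.
- move=> F mF tF mfF.
  rewrite (_ : (fun _ => _) = (fun g : borel (curve X) =>
      \sum_(i <oo) path_measure (g : curve X) (F i))%E).
    by apply: ge0_emeasurable_sum => [k g _ _|k _]; [exact: measure_ge0|exact: mfF].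
  apply/funext => g; rewrite measure_semi_bigcup//.
  exact: bigcupT_measurable.
Qed.

End length_inside_open.

(** * Regularity of finite Borel measures on a metric space *)
Section outer_regularity.
Variables (R : realType) (X : completeMetricType R).
Implicit Types (mu : {measure set (borel X) -> \bar R}) (A B : set (borel X)).

Definition regular_set mu A := forall e : R, 0 < e ->
  exists F U : set X, [/\ closed F, open U, F `<=` A, A `<=` U & (mu (U `\` F) < e%:E)%E].

Let measurable_diff (U F : set X) : open U -> closed F ->
  measurable (U `\` F : set (borel X)).
Proof. by move=> oU cF; apply: measurableD; [exact: borel_open|exact: borel_closed]. Qed.

Lemma metric_ball_open (x : X) (r : R) : open (ball x r : set X).
Proof.
rewrite openE => y; rewrite ballEmdist/= => xy; apply/nbhs_ballP.
exists (r - mdist x y); first by rewrite /= subr_gt0.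
move=> z; rewrite !ballEmdist/= => yz.
by have := metric_triangle x y z; lra.
Qed.

Lemma nonincreasing_measure_lt mu (D : nat -> set (borel X)) (e : \bar R) :
  (mu setT < +oo)%E -> (forall n, measurable (D n)) -> nonincreasing_seq D ->
  (mu (\bigcap_n D n) < e)%E -> exists n, (mu (D n) < e)%E.
Proof.
move=> muT mD ndD De.
have mcap : measurable (\bigcap_n D n) by apply: bigcapT_measurable.
have D0 : (mu (D 0%N) < +oo)%E.
  by apply: le_lt_trans muT; apply: le_measure; rewrite ?inE//; exact: measurableT.
have cvD := nonincreasing_cvg_mu D0 mD mcap ndD.
have : \forall n \near \oo, (mu (D n) < e)%E.
  apply: (cvD [set x | (x < e)%E]).
  by apply: open_nbhs_nbhs; split => //; exact: open_ereal_lt_ereal.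
by move=> [n _ /(_ n (leqnn _)) ne]; exists n.
Qed.

(** An open set is the increasing union of the closed sets of points at distance
    at least [1/(n+1)] from its complement. *)
Lemma open_regular mu (U : set X) : (mu setT < +oo)%E -> open U -> regular_set mu U.
Proof.
move=> muT oU e e0.
pose F n : set X := [set x | forall y, mdist x y < n.+1%:R^-1 -> U y].
have cF n : closed (F n).
  rewrite -[X in closed X]setCK; apply: open_closedC.
  have -> : ~` (F n) = \bigcup_(y in ~` U) (ball y n.+1%:R^-1 : set X).
    apply/seteqP; split => x.
      move=> /existsNP[y /not_implyP[xy Uy]]; exists y => //.
      by rewrite ballEmdist/= metric_sym.
    by move=> [y Uy]; rewrite ballEmdist/= metric_sym => xy /(_ y xy).
  by apply: bigcup_open => y _; exact: metric_ball_open.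
have FU n : F n `<=` U by move=> x; apply; rewrite mdistxx invr_gt0.
have UF : U = \bigcup_n F n.
  apply/seteqP; split => x; last by move=> [n _]; exact: FU.
  move=> Ux; have /nbhs_ballP[d /= d0 dU] : nbhs x U by exact: open_nbhs_nbhs.
  have [n] := ltr_add_invr (y := 0) (x := d) d0; rewrite add0r => nd.
  by exists n => // y xy; apply: dU; rewrite ballEmdist/=; exact: lt_trans nd.
have ndF : nonincreasing_seq (fun n => U `\` F n : set (borel X)).
  move=> m n mn; apply/subsetPset => x [Ux nFx]; split => // mFx; apply: nFx => y xy.
  by apply: mFx; apply: (lt_le_trans xy); rewrite lef_pV2 ?posrE// ler_nat ltnS.
have mUF n : measurable (U `\` F n : set (borel X)) by exact: measurable_diff.
have cap0 : \bigcap_n (U `\` F n : set (borel X)) = set0.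
  apply/seteqP; split => // x h; have [Ux _] := h 0%N I.
  by move: Ux; rewrite UF => -[n _]; have [] := h n I.
have [|n ne] := @nonincreasing_measure_lt mu _ e%:E muT mUF ndF.
  by rewrite cap0 measure0 lte_fin.
by exists (F n), U; split.
Qed.

(** The sets that can be approximated from inside by closed sets and from
    outside by open ones form a sigma-algebra. *)
Lemma finite_measure_regular mu A : (mu setT < +oo)%E -> measurable A -> regular_set mu A.
Proof.
move=> muT; rewrite /measurable/=.
suff : <<s @open X >> `<=` regular_set mu by exact.
apply: smallest_sub; last by move=> U; exact: open_regular.
split.
- by apply: open_regular => //; exact: open0.
- move=> B rB e e0; rewrite setTD.
  have [F [U [cF oU FB BU lt_e]]] := rB e e0.
  exists (~` U), (~` F); split.
  + exact: open_closedC.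
  + exact: closed_openC.
  + exact: subsetC.
  + exact: subsetC.
  + by rewrite setDE setCK setIC -setDE.
- move=> B rB e e0.
  have e20 : 0 < e / 2 by rewrite divr_gt0.
  have e2 n : 0 < (e / 2) / (2 ^ n.+1)%:R by rewrite divr_gt0// ltr0n expn_gt0.
  have /choice[FU FUP] : forall n, exists FU : set X * set X,
      [/\ closed FU.1, open FU.2, FU.1 `<=` B n, B n `<=` FU.2 &
        (mu (FU.2 `\` FU.1) < ((e / 2) / (2 ^ n.+1)%:R)%:E)%E].
    by move=> n; have [F [U h]] := rB n _ (e2 n); exists (F, U).
  (* The union of all the closed sets need not be closed: a finite union is used,
     and continuity from above makes the loss small. *)
  pose U := \bigcup_n (FU n).2; pose F n := \bigcup_(i in `I_n) (FU i).1.
  have cF n : closed (F n).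
    by apply: closed_bigcup => [|i _]; [exact: finite_II|have [] := FUP i].
  have oU : open U by apply: bigcup_open => n _; have [] := FUP n.
  have mD n : measurable ((FU n).2 `\` (FU n).1 : set (borel X)).
    by have [cFn oUn _ _ _] := FUP n; exact: measurable_diff.
  have mUF n : measurable (U `\` F n : set (borel X)) by exact: measurable_diff.
  have [||n ne] := @nonincreasing_measure_lt mu (fun n => U `\` F n) e%:E muT mUF.
  + move=> m n mn; apply/subsetPset => x [Ux nFx]; split => // -[i /= im Fi].
    by apply: nFx; exists i => //=; exact: leq_trans mn.
  + apply: (@le_lt_trans _ _ (e / 2)%:E); last by rewrite lte_fin ltr_pdivrMr//; lra.
    apply: (@le_trans _ _ (\sum_(n <oo) mu ((FU n).2 `\` (FU n).1))%E).
      apply: measure_sigma_subadditive => //; first exact: bigcapT_measurable.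
      move=> x h; have [[n _ Unx] _] := h 0%N I; exists n => //; split => // Fnx.
      by have [_] := h n.+1 I; apply; exists n => //=.
    apply: (@le_trans _ _ (\sum_(n <oo) ((e / 2) / (2 ^ n.+1)%:R)%:E)%E).
      by apply: lee_nneseries => // n _ ; have [_ _ _ _ /ltW] := FUP n.
    by apply: (epsilon_trick0 xpredT); exact: ltW.
  exists (F n), U; split => //.
  + by move=> x [i _ Fi]; exists i => //; have [_ _ + _ _] := FUP i; exact.
  + by move=> x [i _ Bi]; exists i => //; have [_ _ _ + _] := FUP i; exact.
Qed.

End outer_regularity.

(** * From open sets to all Borel weights *)
Section Lnorm_extras.
Local Open Scope ereal_scope.
Context d (T : measurableType d) (R : realType) (m : {measure set T -> \bar R}).
Variable p : R.
Hypothesis p_ge1 : (1 <= p)%R.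

Let p_gt0 : (0 < p)%R. Proof. exact: lt_le_trans p_ge1. Qed.

Lemma Lnorm_ge0E (f : T -> \bar R) : (forall x, 0 <= f x) ->
  'N[m]_p%:E[f] = (\int[m]_x (f x `^ p)) `^ p^-1.
Proof.
move=> f0; rewrite unlock /Lnorm; congr (_ `^ _); apply: eq_integral => x _.
by rewrite gee0_abs.
Qed.

Lemma Lnorm_scale (a : R) (f : T -> \bar R) : (0 <= a)%R -> measurable_fun setT f ->
  (forall x, 0 <= f x) -> 'N[m]_p%:E[(fun x => a%:E * f x)] = a%:E * 'N[m]_p%:E[f].
Proof.
move=> a0 mf f0; rewrite !Lnorm_ge0E//; last by move=> x; rewrite mule_ge0.
transitivity ((\int[m]_x ((a `^ p)%R%:E * f x `^ p)) `^ p^-1).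
  congr (_ `^ _); apply: eq_integral => x _.
  by rewrite poweRM// poweR_EFin.
rewrite ge0_integralZl_EFin ?powR_ge0//; last 2 first.
- by move=> x _; exact: poweR_ge0.
- exact: (measurableT_comp (measurable_poweR p)).
rewrite poweRM ?lee_fin ?powR_ge0 ?integral_ge0//; last by move=> x _; exact: poweR_ge0.
by rewrite poweR_EFin -powRrM mulfV ?gt_eqF// powRr1.
Qed.

Lemma Lnorm_scale_indic (a : R) (A : set T) : (0 <= a)%R -> measurable A ->
  'N[m]_p%:E[(fun x => (a * \1_A x)%:E)] = a%:E * m A `^ p^-1.
Proof.
move=> a0 mA; rewrite (_ : (fun _ => _) = fun x => a%:E * (\1_A x)%:E)//.
rewrite Lnorm_scale//; last by apply/measurable_EFinP; exact: measurable_indic.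
congr (_ * _); rewrite Lnorm_ge0E//; congr (_ `^ _).
rewrite -[A in RHS]setIT -integral_indic//; apply: eq_integral => x _.
by rewrite poweR_EFin indicE; case: (_ \in _); rewrite ?powR1 ?powR0// gt_eqF.
Qed.

Lemma Lnorm_le (f g : T -> \bar R) : measurable_fun setT f -> measurable_fun setT g ->
  (forall x, 0 <= f x <= g x) -> 'N[m]_p%:E[f] <= 'N[m]_p%:E[g].
Proof.
move=> mf mg fg; have f0 x : 0 <= f x by have /andP[] := fg x.
have g0 x : 0 <= g x by have /andP[fx] := fg x; exact: le_trans.
rewrite !Lnorm_ge0E//; apply: gt0_ler_poweR.
- by rewrite invr_ge0 ltW.
- by rewrite in_itv/= leey andbT integral_ge0// => x _; exact: poweR_ge0.
- by rewrite in_itv/= leey andbT integral_ge0// => x _; exact: poweR_ge0.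
apply: ge0_le_integral => //.
- by move=> x _; exact: poweR_ge0.
- exact: (measurableT_comp (measurable_poweR p)).
- exact: (measurableT_comp (measurable_poweR p)).
move=> x _; have /andP[_ fgx] := fg x; apply: gt0_ler_poweR => //; first exact: ltW.
- by rewrite in_itv/= leey andbT.
- by rewrite in_itv/= leey andbT.
Qed.

End Lnorm_extras.

Section extension_to_borel.
Local Open Scope ereal_scope.
Variables (R : realType) (X : completeMetricType R).
Variables (m nu : {measure set (borel X) -> \bar R}).
Hypothesis m_bounded : finite_on_bounded m.
Variables (p M : R) (K : (X -> R) -> Prop).
Hypotheses (p_ge1 : (1 <= p)%R) (M_ge0 : (0 <= M)%R)
  (KD : forall f g, K f -> K g -> K (f \+ g)%R)
  (K_indic : forall (a : R) (U : set X), (0 <= a)%R -> open U -> metric_bounded U ->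
     K (fun x => a * \1_U x)%R)
  (K_nu : forall f : borel X -> R, measurable_fun setT f -> (forall x, 0 <= f x)%R -> K f ->
     \int[nu]_x (f x)%:E <= M%:E * 'N[m]_p%:E[EFin \o f]).

Let p_gt0 : (0 < p)%R. Proof. exact: lt_le_trans p_ge1. Qed.

(** The open balls are bounded, hence of finite measure, and cover the space:
    they make [m] sigma-finite. *)
Definition exhaustion (n : nat) : set (borel X) := ball (point : X) n%:R.

Lemma exhaustion_open n : open (exhaustion n : set X).
Proof. exact: metric_ball_open. Qed.

Lemma exhaustion_measurable n : measurable (exhaustion n).
Proof. apply: borel_open; exact: exhaustion_open. Qed.

Lemma exhaustion_bounded n : metric_bounded (exhaustion n : set X).
Proof.
exists (n%:R + n%:R)%R => x y; rewrite /exhaustion !ballEmdist/= => nx ny.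
have := metric_triangle x (point : X) y; rewrite (metric_sym x point); lra.
Qed.

Lemma exhaustion_le k n : (k <= n)%N -> exhaustion k `<=` exhaustion n.
Proof.
by move=> kn x; rewrite /exhaustion !ballEmdist/= => /lt_le_trans; apply; rewrite ler_nat.
Qed.

Lemma exhaustionT : \bigcup_n exhaustion n = setT.
Proof.
apply/seteqP; split => // x _; exists (Num.bound (mdist (point : X) (x : X))) => //.
by rewrite /exhaustion ballEmdist/=; apply: archi_boundP; exact: mdist_ge0.
Qed.

Lemma exhaustion_lty n : m (exhaustion n) < +oo.
Proof. by apply: m_bounded; [exact: exhaustion_measurable|exact: exhaustion_bounded]. Qed.

(** [f] is approximated in L^p from above, so that the integral of [f] for [nu]
    is at most that of the approximation, which is in [K]. *)
Let approximable (f : X -> R) := forall e : R, (0 < e)%R -> exists d : borel X -> R,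
  [/\ measurable_fun setT d, forall x, (0 <= d x)%R, K (f \+ d)%R &
      'N[m]_p%:E[EFin \o d] <= e%:E].

(** By outer regularity of the restriction of [m] to a ball, [A] is contained in
    a bounded open set that exceeds it by less than [eta]. *)
Let approximable_indic (a : R) (A : set (borel X)) n : (0 <= a)%R -> measurable A ->
  A `<=` exhaustion n -> approximable (fun x => a * \1_A x)%R.
Proof.
(* [a * eta ^ (1/p) <= e], also when [a = 0]. *)
move=> a0 mA An e e0; pose eta := ((e / (a + 1)) `^ p)%R.
have a1 : (0 < a + 1)%R by rewrite ltr_wpDl.
have ea0 : (0 < e / (a + 1))%R by rewrite divr_gt0.
have eta0 : (0 < eta)%R by rewrite powR_gt0.
have fin_restr : mrestr m (exhaustion_measurable n) setT < +oo.
  by rewrite /mrestr setTI exhaustion_lty.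
have [F [U [cF oU FA AU lt_eta]]] :=
  @finite_measure_regular R X (mrestr m (exhaustion_measurable n)) A fin_restr mA _ eta0.
pose V := (U `&` exhaustion n : set (borel X)).
have oV : open (V : set X) by apply: openI => //; exact: exhaustion_open.
have mV : measurable V by exact: borel_open.
have mVA : measurable (V `\` A) by exact: measurableD.
have AV : A `<=` V by move=> x Ax; split; [exact: AU|exact: An].
have lt_VA : m (V `\` A) <= eta%:E.
  apply: ltW; apply: le_lt_trans lt_eta; rewrite /mrestr; apply: le_measure; rewrite ?inE//.
    apply: measurableI; last exact: exhaustion_measurable.
    by apply: measurableD; [exact: borel_open|exact: borel_closed].
  by move=> x [[Ux nx] nAx]; split => //; split => // /FA.
exists (fun x => a * \1_(V `\` A) x)%R; split.
- by apply: measurable_funM => //; exact: measurable_indic.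
- by move=> x; rewrite mulr_ge0.
- rewrite (_ : _ \+ _ = (fun x => a * \1_V x))%R.
    apply: K_indic => //; have [c cn] := exhaustion_bounded n.
    by exists c => x y [_ nx] [_ ny]; exact: cn.
  apply/funext => x /=; rewrite -mulrDr; congr (_ * _)%R; rewrite !indicE.
  have [Ax|nAx] := pselect (A x).
    by rewrite (mem_set Ax) (mem_set (AV _ Ax)) memNset ?addr0// => -[].
  have [Vx|nVx] := pselect (V x).
    by rewrite (memNset nAx) (mem_set Vx) mem_set ?add0r.
  by rewrite (memNset nAx) (memNset nVx) memNset ?addr0// => -[].
rewrite Lnorm_scale_indic//.
apply: (@le_trans _ _ (a%:E * (e / (a + 1))%:E)); last first.
  by rewrite -EFinM lee_fin mulrA ler_pdivrMr// mulrDr mulr1 mulrC lerDl ltW.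
rewrite lee_wpmul2l ?lee_fin//.
have -> : (e / (a + 1))%:E = eta%:E `^ p^-1.
  by rewrite poweR_EFin /eta -powRrM mulfV ?gt_eqF// powRr1// ltW.
apply: gt0_ler_poweR => //; first by rewrite invr_ge0 ltW.
- by rewrite in_itv/= leey measure_ge0.
- by rewrite in_itv/= leey lee_fin ltW.
Qed.

Let approximableD f g : approximable f -> approximable g -> approximable (f \+ g)%R.
Proof.
move=> af ag e e0; have e20 : (0 < e / 2)%R by rewrite divr_gt0.
have [d1 [md1 d10 Kd1 Nd1]] := af _ e20; have [d2 [md2 d20 Kd2 Nd2]] := ag _ e20.
exists (d1 \+ d2)%R; split.
- exact: measurable_funD.
- by move=> x; rewrite addr_ge0.
- rewrite (_ : _ \+ _ = (f \+ d1) \+ (g \+ d2))%R; first exact: KD.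
  by apply/funext => x /=; rewrite addrACA.
apply: (le_trans (minkowski_EFin m md1 md2 p_ge1)).
by rewrite (splitr e) EFinD leeD.
Qed.

Let approximable_sum (I : eqType) (s : seq I) (f : I -> X -> R) :
  (forall i, i \in s -> approximable (f i)) ->
  approximable (fun x => \sum_(i <- s) f i x)%R.
Proof.
elim: s => [|i s ih] h.
  have := @approximable_indic 0%R set0 0%N (lexx _) measurable0 (@sub0set _ _).
  congr approximable; apply/funext => x; by rewrite big_nil mul0r.
rewrite (_ : (fun _ => _) = (f i) \+ (fun x => \sum_(i <- s) f i x))%R; last first.
  by apply/funext => x; rewrite big_cons.
apply: approximableD; first by apply: h; rewrite mem_head.
by apply: ih => j js; apply: h; rewrite in_cons js orbT.
Qed.

Import HBNNSimple.

Let approximable_simple (h : {nnsfun (borel X) >-> R}) n :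
  approximable (fun x => h x * \1_(exhaustion n) x)%R.
Proof.
rewrite (_ : (fun _ => _) = fun x => \sum_(y <- finmap.enum_fset (fset_set (range h)))
    (`|y| * \1_(h @^-1` [set y] `&` exhaustion n) x))%R; last first.
  apply/funext => x; rewrite fimfunE fsbig_finite//= big_distrl/=.
  apply: eq_big_seq => y; rewrite in_fset_set// inE => -[z _ <-].
  by rewrite ger0_norm// indicI mulrA.
apply: approximable_sum => y _; apply: (@approximable_indic _ _ n) => //.
by apply: measurableI => //; exact: exhaustion_measurable.
Qed.

Let approximable_nu (f : borel X -> R) : measurable_fun setT f ->
  (forall x, 0 <= f x)%R -> approximable f ->
  \int[nu]_x (f x)%:E <= M%:E * 'N[m]_p%:E[EFin \o f].
Proof.
move=> mf f0 af.
have [->|Noo] := eqVneq ('N[m]_p%:E[EFin \o f]) +oo.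
  have := M_ge0; rewrite le_eqVlt => /predU1P[M0|M_gt0]; last first.
    by rewrite gt0_muley ?lte_fin// leey.
  rewrite -M0 mul0e.
  have [d [md d0 Kd Nd]] := af 1%R ltr01.
  have mfd : measurable_fun setT (f \+ d)%R by exact: measurable_funD.
  have := K_nu mfd (fun x => addr_ge0 (f0 x) (d0 x)) Kd; rewrite -M0 mul0e.
  apply: le_trans; apply: ge0_le_integral => //.
  - by move=> x _; rewrite lee_fin.
  - exact/measurable_EFinP.
  - exact/measurable_EFinP.
  - by move=> x _; rewrite lee_fin lerDl.
have Nfin : 'N[m]_p%:E[EFin \o f] \is a fin_num.
  by rewrite ge0_fin_numE ?Lnorm_ge0// ltey.
apply/lee_addgt0Pr => e e0; pose e' := (e / (M + 1))%R.
have M1 : (0 < M + 1)%R by rewrite ltr_wpDl.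
have [d [md d0 Kd Nd]] := af e' (divr_gt0 e0 M1).
have mfd : measurable_fun setT (f \+ d)%R by exact: measurable_funD.
apply: (@le_trans _ _ (\int[nu]_x ((f \+ d)%R x)%:E)).
  apply: ge0_le_integral => //.
  - by move=> x _; rewrite lee_fin.
  - exact/measurable_EFinP.
  - exact/measurable_EFinP.
  - by move=> x _; rewrite lee_fin lerDl.
apply: (le_trans (K_nu mfd (fun x => addr_ge0 (f0 x) (d0 x)) Kd)).
apply: (@le_trans _ _ (M%:E * ('N[m]_p%:E[EFin \o f] + e'%:E))).
  rewrite lee_wpmul2l ?lee_fin//; apply: (le_trans (minkowski_EFin m mf md p_ge1)).
  by rewrite leeD2l.
have e'0 : (0 <= e')%R by rewrite divr_ge0 ?(ltW e0) ?(ltW M1).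
rewrite ge0_muleDr ?Lnorm_ge0 ?lee_fin//; apply: leeD2l; rewrite -EFinM lee_fin.
by rewrite /e' mulrA ler_pdivrMr// mulrDr mulr1 mulrC lerDl ltW.
Qed.

(** [f] is the increasing limit of simple functions of bounded support, each of
    which is a sum of multiples of indicators. *)
Lemma integral_le_Lnorm (f : borel X -> \bar R) : measurable_fun setT f ->
  (forall x, 0 <= f x) -> \int[nu]_x f x <= M%:E * 'N[m]_p%:E[f].
Proof.
move=> mf f0.
pose h n : {nnsfun (borel X) >-> R} := nnsfun_approx measurableT mf n.
pose g n (x : borel X) := (h n x * \1_(exhaustion n) x)%R.
have g0 n x : (0 <= g n x)%R by rewrite mulr_ge0.
have mg n : measurable_fun setT (g n).
  by apply: measurable_funM => //; apply: measurable_indic; exact: exhaustion_measurable.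
have hnd x k n : (k <= n)%N -> (h k x <= h n x)%R.
  by move=> kn; have /lefP := nd_nnsfun_approx measurableT mf kn; exact.
have gnd x : nondecreasing_seq (fun n => (g n x)%:E).
  move=> k n kn; rewrite lee_fin ler_pM//; first exact: hnd.
  rewrite !indicE; case: (boolP (x \in exhaustion k)) => // /set_mem xk.
  by rewrite mem_set//; exact: exhaustion_le xk.
have cvh x : (h n x)%:E @[n --> \oo] --> f x.
  exact: (cvg_nnsfun_approx measurableT mf (fun x _ => f0 x)).
have cvg_ x : (g n x)%:E @[n --> \oo] --> f x.
  have : (\bigcup_n exhaustion n) x by rewrite exhaustionT.
  move=> [k _ xk]; apply: cvg_trans (cvh x); apply: near_eq_cvg; exists k => // n /= kn.
  by rewrite /g indicE mem_set ?mulr1//; exact: exhaustion_le xk.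
have gf n x : (g n x)%:E <= f x.
  by apply: (cvge_ge _ (cvg_ x)); exists n => // k /= nk; exact: gnd.
have -> : \int[nu]_x f x = \int[nu]_x limn (fun n => (g n x)%:E).
  by apply: eq_integral => x _; apply/esym/cvg_lim.
rewrite monotone_convergence//; last 2 first.
- by move=> n; exact/measurable_EFinP.
- by move=> n x _; rewrite lee_fin.
apply: lime_le.
  apply: ereal_nondecreasing_is_cvgn => k n kn; apply: ge0_le_integral => //.
  - by move=> x _; rewrite lee_fin.
  - exact/measurable_EFinP.
  - exact/measurable_EFinP.
  - by move=> x _; exact: gnd.
apply: nearW => n; apply: (le_trans (approximable_nu (mg n) (g0 n) _)).
  exact: approximable_simple.
rewrite lee_wpmul2l ?lee_fin//; apply: Lnorm_le => //.
- exact/measurable_EFinP.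
- by move=> x /=; rewrite gf lee_fin g0.
Qed.

End extension_to_borel.

(** * Mixtures of measures and densities *)
Section mixture.
Local Open Scope ereal_scope.
Context d d' (T : measurableType d) (S : measurableType d') (R : realType).
Variables (mu : {measure set T -> \bar R}) (nu : {measure set S -> \bar R}).
Variable J : T -> (S -> \bar R) -> \bar R.
Let pos (f : S -> \bar R) := measurable_fun setT f /\ forall x, 0 <= f x.
Hypotheses (J_ge0 : forall t f, pos f -> 0 <= J t f)
  (JD : forall t f g, pos f -> pos g -> J t (f \+ g) = J t f + J t g)
  (JZ : forall t (a : R) f, (0 <= a)%R -> pos f -> J t (fun x => a%:E * f x) = a%:E * J t f)
  (J_lim : forall t (f_ : (S -> \bar R)^nat) f, (forall n, pos (f_ n)) ->
     (forall x, nondecreasing_seq (f_ ^~ x)) -> (forall x, f_ n x @[n --> \oo] --> f x) ->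
     nondecreasing_seq (fun n => J t (f_ n)) /\ J t (f_ n) @[n --> \oo] --> J t f)
  (J_measurable : forall A, measurable A ->
     measurable_fun setT (fun t => J t (fun x => (\1_A x)%:E)))
  (J_nu : forall A, measurable A -> nu A = \int[mu]_t J t (fun x => (\1_A x)%:E)).

Import HBNNSimple.

Let mixed (f : S -> \bar R) := [/\ pos f, measurable_fun setT (J ^~ f) &
  \int[nu]_x f x = \int[mu]_t J t f].

Let pos_indic (a : R) A : (0 <= a)%R -> measurable A -> pos (fun x => a%:E * (\1_A x)%:E).
Proof.
move=> a0 mA; split; last by move=> x; rewrite mule_ge0 ?lee_fin.
by apply: measurable_funeM; apply/measurable_EFinP; exact: measurable_indic.
Qed.

Let mixed_indic (a : R) A : (0 <= a)%R -> measurable A ->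
  mixed (fun x => a%:E * (\1_A x)%:E).
Proof.
move=> a0 mA; have p1 := @pos_indic 1%R A ler01 mA.
have p1A : pos (fun x => (\1_A x)%:E).
  by move: p1; rewrite (_ : (fun _ => _) = (fun x => (\1_A x)%:E))//; apply/funext => x;
    rewrite mul1e.
have JE : (fun t => J t (fun x => a%:E * (\1_A x)%:E)) =
    (fun t => a%:E * J t (fun x => (\1_A x)%:E)).
  by apply/funext => t; exact: JZ.
split; first exact: pos_indic.
  by rewrite JE; apply: measurable_funeM; exact: J_measurable.
under [RHS]eq_integral do rewrite JZ//.
rewrite !ge0_integralZl_EFin//.
- by rewrite integral_indic// setIT J_nu.
- by move=> t _; exact: J_ge0.
- exact: J_measurable.
- by case: p1A.
Qed.

Let mixedD f g : mixed f -> mixed g -> mixed (f \+ g).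
Proof.
move=> [pf mf fE] [pg mg gE]; split.
- by split; [apply: emeasurable_funD; [case: pf|case: pg]|
    move=> x; rewrite adde_ge0//; [case: pf|case: pg]].
- rewrite (_ : (fun _ => _) = (fun t => J t f + J t g)); first exact: emeasurable_funD.
  by apply/funext => t; exact: JD.
under [RHS]eq_integral do rewrite JD//.
rewrite !ge0_integralD//; first by rewrite fE gE.
- by move=> t _; exact: J_ge0.
- by move=> t _; exact: J_ge0.
- by move=> x _; case: pf.
- by case: pf.
- by move=> x _; case: pg.
- by case: pg.
Qed.

Let mixed_sum (I : eqType) (s : seq I) (f : I -> S -> \bar R) :
  (forall i, i \in s -> mixed (f i)) -> mixed (fun x => \sum_(i <- s) f i x).
Proof.
elim: s => [|i s ih] h.
  have := mixed_indic (lexx 0%R) (@measurable0 _ S).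
  by congr mixed; apply/funext => x; rewrite big_nil mul0e.
rewrite (_ : (fun _ => _) = (f i) \+ (fun x => \sum_(i <- s) f i x)); last first.
  by apply/funext => x; rewrite big_cons.
apply: mixedD; first by apply: h; rewrite mem_head.
by apply: ih => j js; apply: h; rewrite in_cons js orbT.
Qed.

Let mixed_simple (h : {nnsfun S >-> R}) : mixed (fun x => (h x)%:E).
Proof.
rewrite (_ : (fun _ => _) = fun x => \sum_(y <- finmap.enum_fset (fset_set (range h)))
    (`|y|%:E * (\1_(h @^-1` [set y]) x)%:E)); last first.
  apply/funext => x; rewrite fimfunE fsbig_finite//= -sumEFin.
  apply: eq_big_seq => y; rewrite in_fset_set// inE => -[z _ <-].
  by rewrite ger0_norm// EFinM.
by apply: mixed_sum => y _; exact: mixed_indic.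
Qed.

(** The standard passage from indicators to nonnegative functions, for a family
    [J t] of integrals: it covers both mixtures of measures, where [J t] is the
    integral for the [t]-th measure, and densities, where [J t g = g t * f t]. *)
Lemma integral_mixture (f : S -> \bar R) : measurable_fun setT f ->
  (forall x, 0 <= f x) ->
  measurable_fun setT (J ^~ f) /\ \int[nu]_x f x = \int[mu]_t J t f.
Proof.
move=> mf f0.
pose h n : {nnsfun S >-> R} := nnsfun_approx measurableT mf n.
have hm n : mixed (fun x => (h n x)%:E) by exact: mixed_simple.
have hnd x : nondecreasing_seq (fun n => (h n x)%:E).
  by move=> k n kn; rewrite lee_fin; have /lefP := nd_nnsfun_approx measurableT mf kn; exact.
have cvh x : (h n x)%:E @[n --> \oo] --> f x.
  exact: (cvg_nnsfun_approx measurableT mf (fun x _ => f0 x)).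
have ph n : pos (fun x => (h n x)%:E) by case: (hm n).
have Jnd t := (J_lim t ph hnd cvh).1; have Jcv t := (J_lim t ph hnd cvh).2.
have mJ n : measurable_fun setT (fun t => J t (fun x => (h n x)%:E)) by case: (hm n).
split.
  apply: (@emeasurable_fun_cvg _ _ _ setT (fun n t => J t (fun x => (h n x)%:E)) (J ^~ f) mJ).
  by move=> t _; exact: Jcv.
transitivity (limn (fun n => \int[nu]_x (h n x)%:E)).
  rewrite -monotone_convergence//.
  - by apply: eq_integral => x _; apply/esym/cvg_lim.
  - by move=> n; case: (ph n).
  - by move=> n x _; rewrite lee_fin.
transitivity (limn (fun n => \int[mu]_t J t (fun x => (h n x)%:E))).
  by congr (limn _); apply/funext => n; case: (hm n).
rewrite -monotone_convergence//.
- by apply: eq_integral => t _; apply/cvg_lim.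
- by move=> n t _; exact: J_ge0.
Qed.

End mixture.

(** Monotonicity allows the case [c = +oo] with [l = 0]. *)
Lemma nondecreasing_cvgeMr (R : realType) (u : (\bar R)^nat) (l c : \bar R) :
  (forall n, 0 <= u n)%E -> (0 <= c)%E -> nondecreasing_seq u -> u n @[n --> \oo] --> l ->
  (u n * c)%E @[n --> \oo] --> (l * c)%E.
Proof.
move=> u0 c0 ndu ul; have [cfin|] := boolP (c \is a fin_num); first exact: cvgeZr.
rewrite ge0_fin_numE// -leNgt leye_eq => /eqP ->.
have ul_le n : (u n <= l)%E.
  by apply: (cvge_ge _ ul); exists n => // k /= nk; exact: ndu.
have l0 : (0 <= l)%E := le_trans (u0 0%N) (ul_le 0%N).
move: l0; rewrite le_eqVlt => /predU1P[l0|l_gt0].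
  have uE n : u n = 0%E by apply/eqP; rewrite eq_le u0 andbT l0.
  by rewrite -l0 mul0e; under eq_fun do rewrite uE mul0e; exact: cvg_cst.
have [n un] : exists n, (0 < u n)%E.
  apply: contrapT => /forallNP h; move: l_gt0; apply/negP; rewrite -leNgt.
  by apply: (cvge_le _ ul); apply: nearW => n; rewrite leNgt; apply/negP.
apply: cvg_near_cst; exists n => // k /= nk; apply/eqP.
by rewrite !gt0_muley// (lt_le_trans un)// ndu.
Qed.

Section density.
Local Open Scope ereal_scope.
Variables (R : realType) (X : completeMetricType R).
Variables (m nu : {measure set (borel X) -> \bar R}).

Lemma integral_density (f g : borel X -> \bar R) : is_density m nu f ->
  measurable_fun setT g -> (forall x, 0 <= g x) ->
  \int[nu]_x g x = \int[m]_x (g x * f x).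
Proof.
move=> [mf f0 fE] mg g0.
have [] // := @integral_mixture _ _ (borel X) (borel X) R m nu
  (fun x g => g x * f x) _ _ _ _ _ _ g mg g0.
- by move=> t h [_ h0]; rewrite mule_ge0.
- by move=> t h k [_ h0] [_ k0] /=; rewrite ge0_muleDl.
- by move=> t a h a0 _; rewrite muleA.
- move=> t h_ h ph hnd hcv; split; last first.
    by apply: nondecreasing_cvgeMr => // n; case: (ph n).
  by move=> k n kn; rewrite lee_wpmul2r// hnd.
- by move=> A mA; apply: emeasurable_funM => //; apply/measurable_EFinP; exact: measurable_indic.
- move=> A mA; rewrite fE// [LHS]integral_mkcond; apply: eq_integral => x _.
  by rewrite patchE indicE; case: (x \in A); rewrite ?mul1e ?mul0e.
Qed.

Hypothesis m_bounded : finite_on_bounded m.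
Hypothesis nu_exhaustion : forall n, nu (@exhaustion R X n) < +oo.
Hypothesis nu_m : nu `<< m.

Let E_ n : set (borel X) := seqDU (@exhaustion R X) n.

Let mE n : measurable (E_ n).
Proof.
apply: measurableD; first exact: exhaustion_measurable.
by apply: bigsetU_measurable => i _; exact: exhaustion_measurable.
Qed.

Let nuE n : nu (E_ n) < +oo.
Proof.
apply: le_lt_trans (nu_exhaustion n); apply: le_measure; rewrite ?inE//.
  exact: exhaustion_measurable.
exact: subDsetl.
Qed.

Let m_sigma_finite : sigma_finite setT m.
Proof.
exists (@exhaustion R X); first by rewrite exhaustionT.
by move=> n; split; [exact: exhaustion_measurable|exact: exhaustion_lty].
Qed.

(** Sigma-finiteness follows from the hypotheses of the section, so the instance
    is attached to a copy of [m]. *)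
Let m' : set (borel X) -> \bar R := m.
HB.instance Definition _ := Measure.on m'.
HB.instance Definition _ := Measure_isSigmaFinite.Build _ _ _ m' m_sigma_finite.

(** On each of the disjoint annuli between consecutive balls [nu] is finite, and
    Radon-Nikodym gives a density; the density of [nu] is their sum. *)
Lemma density_ex : exists f, is_density m nu f.
Proof.
pose nu_ n : {finite_measure set (borel X) -> \bar R} := mfrestr (mE n) (nuE n).
have nu_m_ n : nu_ n `<< m'.
  apply/null_content_dominatesP => A mA mA0; rewrite /nu_ /= /mfrestr /mrestr.
  move/null_content_dominatesP : nu_m => /(_ _ mA mA0) nuA0.
  apply/eqP; rewrite eq_le measure_ge0 andbT -nuA0; apply: le_measure; rewrite ?inE//.
  exact: measurableI.
have /choice[f_ f_P] := fun n => radon_nikodym_sigma_finite (nu_m_ n).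
have mf n : measurable_fun setT (f_ n) by have [_ _ /integrableP[]] := f_P n.
have f_ge0 n x : 0 <= f_ n x by have [] := f_P n.
exists (fun x => \sum_(n <oo) f_ n x); split.
- by apply: ge0_emeasurable_sum.
- by move=> x; exact: nneseries_ge0.
move=> A mA; rewrite integral_nneseries//; last by move=> n; exact: measurable_funTS.
transitivity (\sum_(n <oo) nu (A `&` E_ n)).
  rewrite -measure_semi_bigcup//.
  - by rewrite -setI_bigcupr -seqDU_bigcup_eq exhaustionT setIT.
  - by move=> n; exact: measurableI.
  - by apply: trivIset_setIl; exact: trivIset_seqDU.
  - by apply: bigcupT_measurable => n; exact: measurableI.
by apply: eq_eseriesr => n _; have [_ _ _ <-] := f_P n.
Qed.

End density.

(** * Duality of L^p and L^q *)
Section duality.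
Local Open Scope ereal_scope.
Context d (T : measurableType d) (R : realType) (m : {measure set T -> \bar R}).
Variable p : R.
Hypothesis p_ge1 : (1 <= p)%R.

Let p_gt0 : (0 < p)%R. Proof. exact: lt_le_trans p_ge1. Qed.

Definition conjugate_exponent : R := p / (p - 1).
Local Notation q := conjugate_exponent.

Lemma conjugate_exponentP : (1 < p)%R -> [/\ (1 < q)%R, (p^-1 + q^-1 = 1)%R,
  ((q - 1) * p = q)%R & hoelder_conjugate p%:E = q%:E].
Proof.
move=> p1; have pB : (0 < p - 1)%R by rewrite subr_gt0.
have pq : (p^-1 + q^-1 = 1)%R.
  by rewrite /q; field; rewrite (gt_eqF pB) gt_eqF.
have q1 : (1 < q)%R by rewrite /q ltr_pdivlMr// mul1r gtrBl.
split => //; first by rewrite /q; field; rewrite gt_eqF.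
by rewrite /hoelder_conjugate /= eqe gt_eqF// -EFinB inver (gt_eqF pB).
Qed.

Lemma Lnorm_ae_fin (r : R) (f : T -> \bar R) : (0 < r)%R -> measurable_fun setT f ->
  'N[m]_r%:E[f] < +oo -> \forall x \ae m, f x \is a fin_num.
Proof.
move=> r0 mf; rewrite unlock /Lnorm => /lty_poweRy.
rewrite invr_eq0 gt_eqF// => /(_ isT) lty.
have mg : measurable_fun setT (fun x => `|f x| `^ r).
  by apply: (measurableT_comp (measurable_poweR r)); exact: measurableT_comp.
have ig : m.-integrable setT (fun x => `|f x| `^ r).
  apply/integrableP; split => //.
  by under eq_integral do rewrite (gee0_abs (poweR_ge0 _ _)).
have := integrable_ae measurableT ig.
apply: filterS => x /(_ I); rewrite ge0_fin_numE ?poweR_ge0// => /lty_poweRy.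
by rewrite gt_eqF// => /(_ isT); rewrite fin_num_abs.
Qed.

(** Hoelder's inequality for extended-valued functions and including [p = 1]:
    functions of finite norm are almost everywhere finite, so the real-valued
    inequality applies when [p > 1]. *)
Lemma hoelder_ge0 (f g : T -> \bar R) : measurable_fun setT f -> measurable_fun setT g ->
  (forall x, 0 <= f x) -> (forall x, 0 <= g x) ->
  'N[m]_p%:E[f] < +oo -> 'N[m]_(hoelder_conjugate p%:E)[g] < +oo ->
  \int[m]_x (f x * g x) <= 'N[m]_p%:E[f] * 'N[m]_(hoelder_conjugate p%:E)[g].
Proof.
move=> mf mg f0 g0.
have mfg : measurable_fun setT (fun x => f x * g x) by exact: emeasurable_funM.
move: p_ge1; rewrite le_eqVlt => /predU1P[p1|p1].
  rewrite -p1 hoelder_conjugate1 Lnorm1.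
  have -> : \int[m]_x `|f x| = \int[m]_x f x.
    by apply: eq_integral => x _; rewrite gee0_abs.
  rewrite unlock /Lnorm; case: ifPn => [mT|]; last first.
    rewrite -leNgt measure_le0 => /eqP mT _ _.
    by rewrite null_set_integral// mule0.
  set L := ess_sup _ _ => flty Llty.
  have gL : \forall x \ae m, g x <= L.
    by have := ess_sup_ge m (abse \o g); apply: filterS => x /=; rewrite gee0_abs.
  have L0 : 0 <= L by apply: ess_sup_gee => //; apply: nearW => x /=.
  have Lfin : L \is a fin_num by rewrite ge0_fin_numE.
  rewrite muleC -ge0_integralZl//; last first.
  apply: ae_ge0_le_integral => //.
  - by move=> x _; rewrite mule_ge0.
  - by move=> x _; rewrite mule_ge0.
  - exact: emeasurable_funM.
  - by apply: filterS gL => x gx _; rewrite muleC lee_wpmul2r.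
have [q1 pq _ ->] := conjugate_exponentP p1.
have q_gt0 : (0 < q)%R by exact: lt_trans q1.
move=> Nf Ng.
have ff := Lnorm_ae_fin p_gt0 mf Nf; have gf := Lnorm_ae_fin q_gt0 mg Ng.
pose f' := fine \o f; pose g' := fine \o g.
have mf' : measurable_fun setT f' by exact: measurableT_comp.
have mg' : measurable_fun setT g' by exact: measurableT_comp.
have f'0 x : (0 <= f' x)%R by exact: fine_ge0.
have g'0 x : (0 <= g' x)%R by exact: fine_ge0.
have Nle (r : R) (h : T -> \bar R) : (1 <= r)%R -> measurable_fun setT h ->
    (forall x, 0 <= h x) -> 'N[m]_r%:E[EFin \o (fine \o h)] <= 'N[m]_r%:E[h].
  move=> r1 mh h0; apply: Lnorm_le => //.
    by apply/measurable_EFinP; exact: measurableT_comp.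
  move=> x /=; rewrite lee_fin fine_ge0//=.
  by have := h0 x; case: (h x) => //= _; rewrite leey.
have := hoelder m mf' mg' p_gt0 q_gt0 pq; rewrite Lnorm1 => h.
apply: (le_trans _ (le_trans h _)); last first.
  by apply: lee_pmul; rewrite ?Lnorm_ge0 ?Nle//; exact: ltW.
apply: ae_ge0_le_integral => //.
- by move=> x _; rewrite mule_ge0.
- apply: measurableT_comp => //; apply/measurable_EFinP; exact: measurable_funM.
- apply: filterS2 ff gf => x fx gx _ /=.
  by rewrite ger0_norm ?mulr_ge0// EFinM !fineK.
Qed.

Variable B : nat -> set T.
Hypotheses (mB : forall n, measurable (B n)) (B_lty : forall n, m (B n) < +oo)
  (B_le : forall k n, (k <= n)%N -> B k `<=` B n) (BT : \bigcup_n B n = setT).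
Variables (M : R) (f : T -> \bar R).
Hypotheses (M_ge0 : (0 <= M)%R) (mf : measurable_fun setT f) (f0 : forall x, 0 <= f x)
  (f_dual : forall g : T -> \bar R, measurable_fun setT g -> (forall x, 0 <= g x) ->
     \int[m]_x (g x * f x) <= M%:E * 'N[m]_p%:E[g]).

(** For [p = 1]: testing with the indicator of [[f >= M + 1/(k+1)]] inside [B k]
    shows that this set is null. *)
Let dual_Lnorm1 : (p = 1)%R -> 'N[m]_(+oo)[f] <= M%:E.
Proof.
move=> p1; rewrite unlock /Lnorm; case: ifPn => _; last by rewrite lee_fin.
apply/ess_supP.
pose A (k : nat) : set T := B k `&` [set x | (M + k.+1%:R^-1)%:E <= f x].
have mA k : measurable (A k).
  by apply: measurableI => //; rewrite -[X in measurable X]setTI; exact: emeasurable_fun_c_infty.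
have A0 k : m (A k) = 0.
  have Afin : m (A k) < +oo.
    by apply: le_lt_trans (B_lty k); apply: le_measure; rewrite ?inE//; exact: subIsetl.
  have mind : measurable_fun setT (fun x => ((1 : R) * \1_(A k) x)%:E).
    by apply/measurable_EFinP; apply: measurable_funM => //; exact: measurable_indic.
  have := f_dual mind (fun x => ltac:(by rewrite lee_fin mulr_ge0)).
  rewrite Lnorm_scale_indic// mul1e p1 invr1 poweRe1//.
  have : (M + k.+1%:R^-1)%:E * m (A k) <= \int[m]_x (((1 : R) * \1_(A k) x)%:E * f x).
    have -> : m (A k) = \int[m]_x (\1_(A k) x)%:E by rewrite integral_indic// setIT.
    rewrite -ge0_integralZl_EFin//; last 2 first.
    - by apply/measurable_EFinP; exact: measurable_indic.
    - by rewrite addr_ge0.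
    apply: ge0_le_integral => //.
    - by move=> x _; rewrite mule_ge0 ?lee_fin ?addr_ge0.
    - by apply: measurable_funeM; apply/measurable_EFinP; exact: measurable_indic.
    - exact: emeasurable_funM.
    move=> x _; rewrite mul1r indicE.
    have [Ax|nAx] := boolP (x \in A k); last by rewrite mule0 mul0e.
    by rewrite mule1 mul1e; have [_] := set_mem Ax.
  move=> /le_trans h /h.
  have := fineK (ltac:(by rewrite ge0_fin_numE ?measure_ge0) : m (A k) \is a fin_num).
  move=> <-; rewrite -!EFinM lee_fin mulrDl gerDl => h'; congr (_%:E).
  apply/eqP; rewrite eq_le fine_ge0// andbT.
  by rewrite -(@pmulr_rle0 _ k.+1%:R^-1)// invr_gt0.
exists (\bigcup_k A k); split.
- exact: bigcupT_measurable.
- apply/eqP; rewrite eq_le measure_ge0 andbT.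
  apply: (@le_trans _ _ (\sum_(k <oo) m (A k))).
    by apply: measure_sigma_subadditive => //; exact: bigcupT_measurable.
  by rewrite eseries0// => k _ _; exact: A0.
move=> x /= /negP; rewrite -ltNge gee0_abs// => Mf.
have [k1 _ xk1] : (\bigcup_n B n) x by rewrite BT.
have [k2 k2f] : exists k : nat, (M + k.+1%:R^-1)%:E <= f x.
  move: Mf; case: (f x) => [r| |]//; last by exists 0%N; rewrite leey.
  rewrite lte_fin -subr_gt0 => Mr; have [k] := ltr_add_invr Mr.
  by rewrite add0r => /ltW h; exists k; rewrite lee_fin -lerBrDl.
exists (maxn k1 k2) => //; split; first by apply: B_le xk1; exact: leq_maxl.
apply: le_trans k2f; rewrite lee_fin lerD2l lef_pV2 ?posrE// ler_nat ltnS.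
exact: leq_maxr.
Qed.

(** For [p > 1]: let [g] be [f] truncated in value and in space, so that
    [I = \int g ^ q] is finite. Testing with [g ^ (q - 1)] gives
    [I <= M * I ^ (1/p)], i.e. [I ^ (1/q) <= M]; let the truncation grow. *)
Let dual_LnormP : (1 < p)%R -> 'N[m]_q%:E[f] <= M%:E.
Proof.
move=> p1; have [q1 pq qp _] := conjugate_exponentP p1.
have q_gt0 : (0 < q)%R by exact: lt_trans q1.
pose g n (x : T) : R := (fine (mine (f x) n%:R%:E) * \1_(B n) x)%R.
have h0 n x : 0 <= mine (f x) (n%:R : R)%:E by rewrite le_min f0 lee_fin ler0n.
have hfin n x : mine (f x) (n%:R : R)%:E \is a fin_num.
  by rewrite ge0_fin_numE// gt_min ltry orbT.
have g0 n x : (0 <= g n x)%R by rewrite mulr_ge0// fine_ge0.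
have mg n : measurable_fun setT (g n).
  apply: measurable_funM; last exact: measurable_indic.
  by apply: measurableT_comp => //; exact: measurable_mine.
have gf n x : (g n x)%:E <= f x.
  rewrite /g EFinM fineK// indicE; case: (_ \in _); last by rewrite mule0.
  by rewrite mule1 ge_min lexx.
have gn n x : (g n x <= n%:R * \1_(B n) x)%R.
  by rewrite ler_wpM2r// -lee_fin fineK// ge_min lexx orbT.
have mgq n (r : R) : measurable_fun setT (fun x => (g n x `^ r)%:E).
  by apply/measurable_EFinP; exact: (measurableT_comp (measurable_powR r)).
have I_fin n : \int[m]_x (g n x `^ q)%:E < +oo.
  apply: (@le_lt_trans _ _ (\int[m]_x ((n%:R `^ q)%:E * (\1_(B n) x)%:E))).
    apply: ge0_le_integral => //.
    - by move=> x _; rewrite lee_fin powR_ge0.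
    - by apply: measurable_funeM; apply/measurable_EFinP; exact: measurable_indic.
    move=> x _; rewrite -EFinM lee_fin; have := gn n x; have := g0 n x.
    rewrite indicE; case: (_ \in _); rewrite ?mulr1 ?mulr0 => gx0 gxn.
      by apply: ge0_ler_powR; rewrite ?nnegrE// ltW.
    have -> : g n x = 0%R by apply/eqP; rewrite eq_le gxn.
    by rewrite powR0// gt_eqF.
  rewrite ge0_integralZl_EFin ?powR_ge0//; last 1 first.
    by apply/measurable_EFinP; exact: measurable_indic.
  by rewrite integral_indic// setIT lte_mul_pinfty// lee_fin powR_ge0.
have I_le n : \int[m]_x (g n x `^ q)%:E <= (M `^ q)%:E.
  set I := \int[m]_x _; have I0 : 0 <= I by apply: integral_ge0 => x _; rewrite lee_fin powR_ge0.
  have I_fin_num : I \is a fin_num by rewrite ge0_fin_numE//; exact: I_fin.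
  have : I <= M%:E * I `^ p^-1.
    have -> : I `^ p^-1 = 'N[m]_p%:E[(fun x => (g n x `^ (q - 1))%:E)].
      have IE : \int[m]_x (`|(g n x `^ (q - 1))%:E| `^ p) = I.
        apply: eq_integral => x _.
        by rewrite gee0_abs ?lee_fin ?powR_ge0// poweR_EFin -powRrM qp.
      by rewrite unlock /Lnorm IE.
    apply: le_trans (f_dual (mgq n (q - 1)%R) (fun x => ltac:(by rewrite lee_fin powR_ge0))).
    apply: ge0_le_integral => //.
    - by move=> x _; rewrite lee_fin powR_ge0.
    - exact: emeasurable_funM.
    move=> x _; apply: (@le_trans _ _ ((g n x `^ (q - 1))%:E * (g n x)%:E)).
      rewrite -EFinM lee_fin -[X in (_ <= _ * X)%R]powRr1// -powRD ?subrK//.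
      by rewrite (gt_eqF q_gt0).
    by rewrite lee_wpmul2l// lee_fin powR_ge0.
  rewrite -(fineK I_fin_num) poweR_EFin -EFinM !lee_fin.
  have : (0 <= fine I)%R by exact: fine_ge0.
  rewrite le_eqVlt => /predU1P[<- _|i0 iM]; first exact: powR_ge0.
  have iE : fine I = (fine I `^ q^-1 * fine I `^ p^-1)%R.
    rewrite -powRD ?(addrC q^-1%R) ?pq ?powRr1 ?ltW//.
    by rewrite oner_eq0.
  have : (fine I `^ q^-1 <= M)%R.
    by rewrite -(@ler_pM2r _ (fine I `^ p^-1)%R) ?powR_gt0// -iE.
  move=> /(@ge0_ler_powR _ q (ltW q_gt0)); rewrite !nnegrE powR_ge0 M_ge0 => /(_ isT isT).
  by rewrite -powRrM mulVf ?gt_eqF// powRr1// ltW.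
have gnd x : nondecreasing_seq (fun n => (g n x)%:E).
  move=> k n kn; rewrite lee_fin /g.
  have [Bx|nBx] := boolP (x \in B k); last by rewrite [in leLHS]indicE (negbTE nBx) mulr0 g0.
  rewrite !indicE Bx (mem_set (B_le kn (set_mem Bx))) !mulr1 fine_le//.
  by rewrite le_min !ge_min lexx/= lee_fin ler_nat kn orbT.
have gcv x : (g n x `^ q)%:E @[n --> \oo] --> (f x) `^ q.
  have [k _ xk] : (\bigcup_n B n) x by rewrite BT.
  have gE n : (k <= n)%N -> (g n x)%:E = mine (f x) n%:R%:E.
    by move=> kn; rewrite /g indicE mem_set ?mulr1 ?fineK//; exact: B_le xk.
  have := f0 x; case fE : (f x) => [r| |]// r0.
    apply: cvg_near_cst; near=> n; apply/eqP.
    rewrite -poweR_EFin gE; last by near: n; exact: nbhs_infty_ge.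
    rewrite fE min_l// lee_fin; near: n; exact: nbhs_infty_ger.
  rewrite poweRyr ?gt_eqF//; apply/cvgeyPge => A; near=> n.
  have -> : g n x = n%:R.
    apply/EFin_inj; rewrite gE; last by near: n; exact: nbhs_infty_ge.
    by rewrite fE min_r ?leey.
  rewrite lee_fin; apply: (@le_trans _ _ n%:R); first by near: n; exact: nbhs_infty_ger.
  have n1 : (1 <= n%:R :> R)%R by rewrite ler1n; near: n; exact: nbhs_infty_gt.
  by rewrite -[leLHS]powRr1//; apply: ler_powR => //; exact: ltW.
have gqnd x : nondecreasing_seq (fun n => (g n x `^ q)%:E).
  move=> k n kn; rewrite lee_fin; apply: ge0_ler_powR; rewrite ?nnegrE//; first exact: ltW.
  by rewrite -lee_fin gnd.
rewrite unlock /Lnorm.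
have -> : M%:E = (M `^ q)%:E `^ q^-1.
  by rewrite poweR_EFin -powRrM mulfV ?gt_eqF// powRr1.
apply: gt0_ler_poweR; first by rewrite invr_ge0 ltW.
- by rewrite in_itv/= leey andbT integral_ge0// => x _; exact: poweR_ge0.
- by rewrite in_itv/= leey andbT lee_fin powR_ge0.
have -> : \int[m]_x (`|f x| `^ q) = \int[m]_x limn (fun n => (g n x `^ q)%:E).
  by apply: eq_integral => x _; rewrite gee0_abs//; apply/esym/cvg_lim.
rewrite monotone_convergence//; last first.
  by move=> n x _; rewrite lee_fin powR_ge0.
apply: lime_le; last by apply: nearW => n; exact: I_le.
apply: ereal_nondecreasing_is_cvgn => k n kn; apply: ge0_le_integral => //.
- by move=> x _; rewrite lee_fin powR_ge0.
- by move=> x _; exact: gqnd.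
Unshelve. all: by end_near. Qed.

Lemma dual_Lnorm : 'N[m]_(hoelder_conjugate p%:E)[f] <= M%:E.
Proof.
move: p_ge1; rewrite le_eqVlt => /predU1P[p1|p1].
  by rewrite -p1 hoelder_conjugate1; exact: dual_Lnorm1.
by have [_ _ _ ->] := conjugate_exponentP p1; exact: dual_LnormP.
Qed.

End duality.

(** * The plan measure as a mixture of measures carried by curves *)
Section path_kernel.
Local Open Scope ereal_scope.
Variables (R : realType) (X : completeMetricType R) (lambda : {nonneg R}).
Implicit Types (g : curve X) (rho : borel X -> \bar R).

(** The contribution of the curve [g] to the plan measure. *)
Definition path_kernel g : {measure set (borel X) -> \bar R} :=
  measure_add
    (mscale lambda (measure_add (\d_(g (I0 R) : borel X)) (\d_(g (I1 R) : borel X))))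
    (path_measure g).

Lemma path_kernelE g A : path_kernel g A =
  lambda%:num%:E * ((\1_A (g (I0 R) : borel X))%:E + (\1_A (g (I1 R) : borel X))%:E) +
  path_measure g A.
Proof.
transitivity (mscale lambda (measure_add (\d_(g (I0 R) : borel X))
    (\d_(g (I1 R) : borel X))) A + path_measure g A).
  exact: measure_addE.
congr (_ + _); transitivity (lambda%:num%:E *
    measure_add (\d_(g (I0 R) : borel X)) (\d_(g (I1 R) : borel X)) A) => //.
by rewrite measure_addE.
Qed.

Lemma path_kernel_lty g A : measurable A -> path_kernel g A < +oo.
Proof.
move=> mA; rewrite path_kernelE lte_add_pinfty ?path_measure_lty//.
by rewrite -EFinD -EFinM ltry.
Qed.

Lemma integral_path_kernel g rho : measurable_fun setT rho -> (forall x, 0 <= rho x) ->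
  \int[path_kernel g]_x rho x =
  lambda%:num%:E * (rho (g (I0 R)) + rho (g (I1 R))) + line_integral g rho.
Proof.
move=> mrho rho0; rewrite ge0_integral_measure_add//; congr (_ + _).
  rewrite ge0_integral_mscale// ge0_integral_measure_add//; congr (_ * (_ + _)).
    by rewrite integral_dirac// diracT mul1e.
  by rewrite integral_dirac// diracT mul1e.
by rewrite ge0_integral_pushforward//; exact: curve_measurable.
Qed.

Lemma evaluation_measurable (t : unitI R) :
  measurable_fun setT (@evaluation R X t).
Proof.
apply: continuous_borel_measurable => U oU; apply: borel_open.
rewrite (_ : _ @^-1` _ = [set g : curve X | U (g t)])//; exact: open_evaluation.
Qed.

Let measurable_eval_indic (t : unitI R) (A : set (borel X)) : measurable A ->
  measurable_fun setT (fun g : borel (curve X) =>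
    (\1_A ((g : curve X) t : borel X))%:E : \bar R).
Proof.
move=> mA; apply/measurable_EFinP.
have mI : measurable_fun setT (\1_A : borel X -> R) by exact: measurable_indic.
exact: (measurableT_comp mI (evaluation_measurable t)).
Qed.

Lemma measurable_path_kernel (A : set (borel X)) : measurable A ->
  measurable_fun setT (fun g : borel (curve X) => path_kernel (g : curve X) A).
Proof.
move=> mA; under eq_fun do rewrite path_kernelE.
apply: emeasurable_funD; last exact: measurable_path_measure.
by apply: measurable_funeM; apply: emeasurable_funD; exact: measurable_eval_indic.
Qed.

Section plan_mixture.
Variable pi : {measure set (borel (curve X)) -> \bar R}.

Definition mixture (A : set (borel X)) : \bar R := \int[pi]_g path_kernel (g : curve X) A.

Let mixture0 : mixture set0 = 0.
Proof. by rewrite /mixture; under eq_integral do rewrite measure0; rewrite integral0. Qed.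

Let mixture_ge0 A : 0 <= mixture A.
Proof. exact: integral_ge0. Qed.

Let mixture_sigma : semi_sigma_additive mixture.
Proof.
move=> F mF tF mU; rewrite /mixture.
have -> : \int[pi]_g path_kernel (g : curve X) (\bigcup_n F n) =
    \sum_(n <oo) \int[pi]_g path_kernel (g : curve X) (F n).
  rewrite -integral_nneseries//; last by move=> n; exact: measurable_path_kernel.
  by apply: eq_integral => g _; rewrite measure_semi_bigcup.
by apply: is_cvg_nneseries => n _ _; exact: mixture_ge0.
Qed.

HB.instance Definition _ := isMeasure.Build _ _ _ mixture
  mixture0 mixture_ge0 mixture_sigma.

Lemma integral_plan_mixture rho : measurable_fun setT rho -> (forall x, 0 <= rho x) ->
  measurable_fun setT (fun g : borel (curve X) => \int[path_kernel (g : curve X)]_x rho x) /\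
  \int[mixture]_x rho x = \int[pi]_g \int[path_kernel (g : curve X)]_x rho x.
Proof.
move=> mrho rho0; pose J (g : borel (curve X)) f := \int[path_kernel (g : curve X)]_x f x.
apply: (@integral_mixture _ _ (borel (curve X)) (borel X) R pi mixture J) => //.
- by move=> g f [_ f0]; exact: integral_ge0.
- by move=> g f h [mf f0] [mh h0]; rewrite /J ge0_integralD.
- by move=> g a f a0 [mf f0]; rewrite /J ge0_integralZl_EFin.
- move=> g f_ f pf ndf fcv; split.
    move=> k n kn; apply: ge0_le_integral => //.
    + by move=> x _; case: (pf k).
    + by case: (pf k).
    + by case: (pf n).
    + by move=> x _; exact: ndf.
  have -> : J g f = \int[path_kernel (g : curve X)]_x limn (f_ ^~ x).
    by apply: eq_integral => x _; apply/esym/cvg_lim.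
  apply: cvg_monotone_convergence => //.
  + by move=> n; case: (pf n).
  + by move=> n x _; case: (pf n).
- move=> A mA; rewrite (_ : (fun _ => _) =
      (fun g : borel (curve X) => path_kernel (g : curve X) A)).
    exact: measurable_path_kernel.
  by apply/funext => g; rewrite /J integral_indic// setIT.
- move=> A mA; apply: eq_integral => g _.
  by rewrite /J integral_indic// setIT.
Qed.

End plan_mixture.

Lemma plan_measureE (pi : {finite_measure set (borel (curve X)) -> \bar R}) A :
  measurable A -> plan_measure lambda%:num pi A = mixture pi A.
Proof.
move=> mA; rewrite /mixture; under [RHS]eq_integral do rewrite path_kernelE.
have m0 := @measurable_eval_indic (I0 R) A mA; have m1 := @measurable_eval_indic (I1 R) A mA.
rewrite ge0_integralD//; last 3 first.
- by move=> g _; rewrite -EFinD -EFinM lee_fin mulr_ge0// addr_ge0.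
- by apply: measurable_funeM; exact: emeasurable_funD.
- exact: measurable_path_measure.
congr (_ + _); rewrite ge0_integralZl_EFin//; last 2 first.
- by move=> g _; rewrite -EFinD lee_fin addr_ge0.
- exact: emeasurable_funD.
rewrite ge0_integralD// ge0_muleDr; last 2 first.
- exact: integral_ge0.
- exact: integral_ge0.
have E t : \int[pi]_g (\1_A ((g : curve X) t : borel X))%:E =
    pushforward pi (@evaluation R X t) A.
  have me : measurable (@evaluation R X t @^-1` A).
    by rewrite -[X in measurable X]setTI; exact: evaluation_measurable.
  by have := integral_indic pi measurableT me; rewrite setIT.
by rewrite !E.
Qed.

End path_kernel.

(** * The modulus as an infimum of norms *)
Section modulus_Lnorm.
Local Open Scope ereal_scope.
Variables (R : realType) (X : completeMetricType R).
Variables (m : {measure set (borel X) -> \bar R}) (p lambda : R).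
Variable Gamma : set (curve X).
Hypotheses (p_ge1 : (1 <= p)%R) (Mod_gt0 : 0 < modulus m lambda p Gamma)
  (Mod_lty : modulus m lambda p Gamma < +oo).

Let p_gt0 : (0 < p)%R. Proof. exact: lt_le_trans p_ge1. Qed.

(** The value [Mod ^ (-1/p)] of the theorem as a real number: [1 / inverse_modulus]
    is the infimum of the L^p norms of the admissible weights. *)
Definition inverse_modulus : R := (fine (modulus m lambda p Gamma) `^ (- p^-1))%R.

Let Mod_fin : modulus m lambda p Gamma \is a fin_num.
Proof. by rewrite fin_real// (lt_trans _ Mod_gt0)// Mod_lty. Qed.

Let Mod1_gt0 : (0 < fine (modulus m lambda p Gamma))%R.
Proof. by rewrite fine_gt0// Mod_gt0. Qed.

Lemma inverse_modulus_gt0 : (0 < inverse_modulus)%R.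
Proof. exact: powR_gt0. Qed.

Lemma inverse_modulusE : modulus m lambda p Gamma `^ (- p^-1) = inverse_modulus%:E.
Proof. by rewrite -{1}(fineK Mod_fin) poweR_EFin. Qed.

Let inverse_modulusV : inverse_modulus^-1%:E = modulus m lambda p Gamma `^ p^-1.
Proof. by rewrite /inverse_modulus powRN invrK -poweR_EFin fineK. Qed.

Lemma admissible_Lnorm_ge rho : admissible lambda Gamma rho ->
  inverse_modulus^-1%:E <= 'N[m]_p%:E[rho].
Proof.
move=> Arho; have [_ rho0 _] := Arho; rewrite Lnorm_ge0E// inverse_modulusV.
apply: gt0_ler_poweR.
- by rewrite invr_ge0 ltW.
- by rewrite in_itv/= leey andbT ltW.
- by rewrite in_itv/= leey andbT integral_ge0// => x _; exact: poweR_ge0.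
by apply: ereal_inf_lbound; exists rho.
Qed.

Lemma admissible_Lnorm_lt b : (inverse_modulus^-1 < b)%R ->
  exists2 rho, admissible lambda Gamma rho & 'N[m]_p%:E[rho] <= b%:E.
Proof.
move=> Mb; have M0 := inverse_modulus_gt0.
have b0 : (0 < b)%R by apply: lt_trans Mb; rewrite invr_gt0.
have : modulus m lambda p Gamma < (b `^ p)%:E.
  rewrite -(fineK Mod_fin) lte_fin.
  have -> : fine (modulus m lambda p Gamma) = ((inverse_modulus^-1) `^ p)%R.
    rewrite /inverse_modulus powRN invrK -powRrM mulVf ?gt_eqF// powRr1//.
    exact: ltW.
  by apply: gt0_ltr_powR; rewrite ?nnegrE// ?invr_ge0 ltW.
move=> /ereal_inf_lt[_ [rho Arho <-]] rhob; exists rho => //.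
have [_ rho0 _] := Arho; rewrite Lnorm_ge0E//.
have -> : b%:E = (b `^ p)%:E `^ p^-1.
  by rewrite poweR_EFin -powRrM mulfV ?gt_eqF// powRr1// ltW.
apply: gt0_ler_poweR.
- by rewrite invr_ge0 ltW.
- by rewrite in_itv/= leey andbT integral_ge0// => x _; exact: poweR_ge0.
- by rewrite in_itv/= leey andbT lee_fin powR_ge0.
exact: ltW.
Qed.

Lemma modulus_gt0_nonempty : Gamma !=set0.
Proof.
have [//|/set0P/negP/negPn/eqP G0] := pselect (Gamma !=set0).
have A0 : admissible lambda Gamma (cst 0) by split => // g; rewrite G0.
have := admissible_Lnorm_ge A0; rewrite Lnorm0 ?lee_fin ?eqe ?gt_eqF//.
by rewrite leNgt invr_gt0 inverse_modulus_gt0.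
Qed.

End modulus_Lnorm.

(** * Existence of an optimal plan *)
Section optimal_plan.
Local Open Scope ereal_scope.
Variables (R : realType) (X : completeMetricType R).
Variables (m : {measure set (borel X) -> \bar R}) (p : R) (lambda : {nonneg R}).
Variable Gamma : set (curve X).
Hypotheses (m_bounded : finite_on_bounded m) (p_ge1 : (1 <= p)%R)
  (Gamma_rect : Gamma `<=` @rectifiable R X) (Gamma_compact : compact Gamma)
  (Mod_gt0 : 0 < modulus m lambda%:num p Gamma)
  (Mod_lty : modulus m lambda%:num p Gamma < +oo).
Implicit Types (g : curve X) (rho : borel X -> R).

Local Notation M := (inverse_modulus m p lambda%:num Gamma).

Let M_gt0 : (0 < M)%R. Proof. exact: inverse_modulus_gt0. Qed.

(** The functional [L rho g] of a real weight, which is finite for the weights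
    in [lsc_weight]. *)
Definition path_action rho g : R := fine (\int[path_kernel lambda g]_x (rho x)%:E).

Definition lsc_weight rho := [/\ measurable_fun setT rho, forall x, (0 <= rho x)%R,
  forall g, \int[path_kernel lambda g]_x (rho x)%:E < +oo &
  lsc_on Gamma (path_action rho)].

Let mEFin rho : measurable_fun setT rho -> measurable_fun setT (fun x => (rho x)%:E).
Proof. by move=> mrho; exact/measurable_EFinP. Qed.

Lemma path_actionE rho g : lsc_weight rho ->
  \int[path_kernel lambda g]_x (rho x)%:E = (path_action rho g)%:E.
Proof.
move=> [_ rho0 rhoy _]; rewrite fineK// ge0_fin_numE//.
by apply: integral_ge0 => x _; rewrite lee_fin.
Qed.

Lemma path_action_ge0 rho g : lsc_weight rho -> (0 <= path_action rho g)%R.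
Proof.
move=> wrho; rewrite -lee_fin -path_actionE//; case: wrho => _ rho0 _ _.
by apply: integral_ge0 => x _; rewrite lee_fin.
Qed.

Lemma path_action_measurable rho : lsc_weight rho ->
  measurable_fun setT (path_action rho : borel (curve X) -> R).
Proof.
move=> [mrho rho0 _ _].
have [] := @integral_plan_mixture R X lambda mzero _ (mEFin mrho) _.
  by move=> x; rewrite lee_fin.
by move=> mJ _; exact: (measurableT_comp (fine_measurable measurableT) mJ).
Qed.

Lemma path_actionD rho rho' : lsc_weight rho -> lsc_weight rho' ->
  forall g, \int[path_kernel lambda g]_x ((rho \+ rho') x)%R%:E =
    (path_action rho g + path_action rho' g)%R%:E.
Proof.
move=> wrho wrho' g; have [mrho rho0 _ _] := wrho; have [mrho' rho'0 _ _] := wrho'.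
rewrite EFinD -!path_actionE// -ge0_integralD//.
- by move=> x _; rewrite lee_fin.
- exact: mEFin.
- by move=> x _; rewrite lee_fin.
- exact: mEFin.
Qed.

Lemma path_actionZ (t : R) rho : (0 <= t)%R -> lsc_weight rho ->
  forall g, \int[path_kernel lambda g]_x (t * rho x)%R%:E = (t * path_action rho g)%R%:E.
Proof.
move=> t0 wrho g; have [mrho rho0 _ _] := wrho.
rewrite EFinM -path_actionE//; under eq_integral do rewrite EFinM.
rewrite ge0_integralZl_EFin//; last exact: mEFin.
by move=> x _; rewrite lee_fin.
Qed.

Lemma lsc_weightD rho rho' : lsc_weight rho -> lsc_weight rho' ->
  lsc_weight (rho \+ rho')%R /\
  path_action (rho \+ rho')%R = (path_action rho \+ path_action rho')%R.
Proof.
move=> wrho wrho'; have E := path_actionD wrho wrho'.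
have E' : path_action (rho \+ rho')%R = (path_action rho \+ path_action rho')%R.
  by apply/funext => g; rewrite /path_action E.
split => //; have [mrho rho0 _ lrho] := wrho; have [mrho' rho'0 _ lrho'] := wrho'.
split; first exact: measurable_funD.
- by move=> x; rewrite addr_ge0.
- by move=> g; rewrite E ltry.
- by rewrite E'; exact: lsc_onD.
Qed.

Lemma lsc_weightZ (t : R) rho : (0 < t)%R -> lsc_weight rho ->
  lsc_weight (t \*o rho)%R /\ path_action (t \*o rho)%R = (t \*o path_action rho)%R.
Proof.
move=> t0 wrho; have E := path_actionZ (ltW t0) wrho.
have E' : path_action (t \*o rho)%R = (t \*o path_action rho)%R.
  by apply/funext => g; rewrite /path_action E.
split => //; have [mrho rho0 _ lrho] := wrho.
split; first exact: measurable_funM.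
- by move=> x /=; rewrite mulr_ge0// ltW.
- by move=> g; rewrite E ltry.
- by rewrite E'; exact: lsc_onZ.
Qed.

(** The two endpoint terms are indicators of open sets of curves, and the third
    one is the length inside [U], a supremum of lower semicontinuous functions. *)
Lemma lsc_weight_indic (a : R) (U : set X) : (0 <= a)%R -> open U ->
  lsc_weight (fun x => a * \1_U x)%R.
Proof.
move=> a0 oU; have mU := borel_open oU.
have fin g : path_kernel lambda g U \is a fin_num.
  by rewrite ge0_fin_numE// path_kernel_lty.
have E g : \int[path_kernel lambda g]_x (a * \1_U x)%R%:E =
    (a * fine (path_kernel lambda g U))%R%:E.
  under eq_integral do rewrite EFinM.
  rewrite ge0_integralZl_EFin//; last first.
    by apply/measurable_EFinP; exact: measurable_indic.
  by rewrite integral_indic// setIT EFinM fineK.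
split.
- by apply: measurable_funM => //; exact: measurable_indic.
- by move=> x; rewrite mulr_ge0.
- by move=> g; rewrite E ltry.
have -> : path_action (fun x => a * \1_U x)%R =
    (fun g => a * fine (path_kernel lambda g U))%R.
  by apply/funext => g; rewrite /path_action E.
have zero : lsc_on Gamma (fun=> 0%R : R).
  move=> c; have [c0|c0] := ltP c 0%R.
    by exists setT; [exact: openT|apply/seteqP; split => g /= []].
  exists set0; first exact: open0.
  by apply/seteqP; split => g /= [] // _; rewrite ltNge c0.
move: a0; rewrite le_eqVlt => /predU1P[<-|a0].
  by apply: lsc_on_eq zero => g _; rewrite mul0r.
apply: (@lsc_onZ _ _ _ a) => //.
have lev t : lsc_on Gamma (fun g => lambda%:num * \1_U (g t))%R.
  have [l0|l0] := eqVneq lambda%:num 0%R.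
    by apply: lsc_on_eq zero => g _; rewrite l0 mul0r.
  apply: (@lsc_onZ _ _ _ lambda%:num); first by rewrite lt_def l0/=.
  apply: open_lsc_on => c.
  rewrite (_ : [set _ | _] = [set g | (c < \1_[set h : curve X | U (h t)] g)%R])//.
  by apply: open_indic; exact: open_evaluation.
have llen : lsc_on Gamma (fun g => fine (path_measure g U)).
  move=> c; exists [set g | c%:E < length_in g U (I0 R) (I1 R)].
    exact: open_length_in.
  have lE g : Gamma g -> (fine (path_measure g U))%:E = length_in g U (I0 R) (I1 R).
    move=> /Gamma_rect rg; rewrite -path_measure_open// fineK//.
    by rewrite ge0_fin_numE// path_measure_lty.
  by apply/seteqP; split => g /= [Gg]; rewrite -lE// lte_fin.
apply: lsc_on_eq (lsc_onD (lsc_onD (lev (I0 R)) (lev (I1 R))) llen) => g _ /=.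
rewrite path_kernelE fineD//; last by rewrite ge0_fin_numE// path_measure_lty.
by rewrite -EFinD -EFinM/= mulrDr.
Qed.

Let K (F : curve X -> R) (N : R) := exists rho, [/\ lsc_weight rho, F = path_action rho &
  M%:E * 'N[m]_p%:E[EFin \o rho] <= N%:E].

(** If [L rho] exceeded [N + e] on [Gamma], then [rho / (N + e)] would be
    admissible, and its norm, at most [N / (M (N + e))], less than [1/M]. *)
Let Gamma_near_minimizer F N e : K F N -> (0 < e)%R ->
  exists2 g, Gamma g & (F g <= N + e)%R.
Proof.
move=> [rho [wrho -> rhoN]] e0; apply: contrapT => noG.
have N0 : (0 <= N)%R.
  by rewrite -lee_fin; apply: le_trans rhoN; rewrite mule_ge0 ?Lnorm_ge0// lee_fin ltW.
have c0 : (0 < N + e)%R by rewrite ltr_wpDl.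
have cF g : Gamma g -> (N + e < path_action rho g)%R.
  by move=> Gg; rewrite ltNge; apply/negP => Fc; apply: noG; exists g.
have [mrho rho0 _ _] := wrho.
have : admissible lambda%:num Gamma (fun x => ((N + e)^-1)%:E * (rho x)%:E).
  split.
  - by apply: measurable_funeM; exact: mEFin.
  - by move=> x; rewrite mule_ge0// lee_fin// invr_ge0 ltW.
  - move=> g Gg; rewrite -integral_path_kernel; first last.
    + by move=> x; rewrite mule_ge0// lee_fin// invr_ge0 ltW.
    + by apply: measurable_funeM; exact: mEFin.
    under eq_integral do rewrite -EFinM.
    rewrite path_actionZ ?invr_ge0 ?(ltW c0)// lee_fin ler_pdivlMl// mulr1.
    exact: ltW (cF _ Gg).
move=> /(admissible_Lnorm_ge p_ge1 Mod_gt0 Mod_lty).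
rewrite Lnorm_scale ?invr_ge0 ?(ltW c0)//; last exact: mEFin.
rewrite leNgt => /negP; apply.
have [y fy] : exists y : R, 'N[m]_p%:E[EFin \o rho] = y%:E.
  have : 'N[m]_p%:E[EFin \o rho] \is a fin_num.
    rewrite ge0_fin_numE ?Lnorm_ge0// ltey; apply/eqP => Ny.
    by move: rhoN; rewrite Ny gt0_muley ?lte_fin// leye_eq.
  by move/fineK => <-; eexists.
move: rhoN; rewrite /comp in fy *; rewrite fy -!EFinM lee_fin lte_fin => MyN.
rewrite ltr_pdivrMl// ltr_pdivlMr// mulrC.
by apply: (le_lt_trans MyN); rewrite ltrDl.
Qed.

(** The minimax principle applies to the weights in [lsc_weight], and outer
    regularity extends the resulting inequality to all Borel weights. *)
Lemma optimal_measure : exists pi : probability (borel (curve X)) R,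
  pi Gamma = 1 /\ forall rho : borel X -> \bar R,
    measurable_fun setT rho -> (forall x, 0 <= rho x) ->
    \int[mixture lambda pi]_x rho x <= M%:E * 'N[m]_p%:E[rho].
Proof.
have G0 := modulus_gt0_nonempty p_ge1 Mod_gt0 Mod_lty.
have [] := @compact_measure R X Gamma K Gamma_compact G0.
- have w0 : lsc_weight (fun x => 0 * \1_setT x)%R by exact: lsc_weight_indic openT.
  have E : (fun x => 0 * \1_setT x)%R = cst 0%R :> (borel X -> R).
    by apply/funext => x; rewrite mul0r.
  rewrite E in w0; exists (cst 0%R); split => //.
    apply/funext => g; rewrite /path_action/= (eq_integral (cst 0)) ?integral0//.
  by rewrite /comp/= Lnorm0 ?mule0// eqe gt_eqF// (lt_le_trans _ p_ge1).
- move=> F G N N' [rho [w -> rhoN]] [rho' [w' -> rhoN']].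
  have [wD <-] := lsc_weightD w w'; exists (rho \+ rho')%R; split => //.
  rewrite EFinD; apply: le_trans (leeD rhoN rhoN').
  rewrite -ge0_muleDr ?Lnorm_ge0// lee_wpmul2l ?lee_fin ?(ltW M_gt0)//.
  by apply: minkowski_EFin => //; [case: w|case: w'].
- move=> t F N t0 [rho [w -> rhoN]].
  have [wZ <-] := lsc_weightZ t0 w; exists (t \*o rho)%R; split => //.
  have [mrho rho0 _ _] := w.
  have -> : EFin \o (t \*o rho)%R = (fun x => t%:E * (rho x)%:E).
    by apply/funext => x /=; rewrite EFinM.
  rewrite Lnorm_scale ?(ltW t0)//; last exact: mEFin.
  by rewrite muleCA EFinM lee_wpmul2l ?lee_fin ?(ltW t0).
- by move=> F N g [rho [wrho -> _]]; exact: path_action_ge0.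
- by move=> F N [rho [[_ _ _ lrho] -> _]].
- by move=> F N [rho [wrho -> _]]; exact: path_action_measurable.
- by move=> F N e; exact: Gamma_near_minimizer.
move=> pi [piG piK]; exists pi; split => //.
apply: (@integral_le_Lnorm R X m (mixture lambda pi) m_bounded p M lsc_weight).
- exact: p_ge1.
- exact: ltW.
- by move=> rho rho' w w'; have [] := lsc_weightD w w'.
- by move=> a U a0 oU _; exact: lsc_weight_indic.
move=> rho mrho rho0 wrho.
have [] := @integral_plan_mixture R X lambda pi _ (mEFin mrho) _.
  by move=> x; rewrite lee_fin.
move=> _ ->; under eq_integral do rewrite path_actionE//.
have [->|Ny] := eqVneq 'N[m]_p%:E[EFin \o rho] +oo.
  by rewrite gt0_muley ?lte_fin// leey.
have Nfin : 'N[m]_p%:E[EFin \o rho] \is a fin_num.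
  by rewrite ge0_fin_numE ?Lnorm_ge0// ltey.
rewrite -(fineK Nfin) -EFinM; apply: piK; exists rho; split => //.
by rewrite EFinM fineK.
Qed.


End optimal_plan.

(** The inequality of [optimal_measure] for indicators shows that the plan
    measure is finite on balls and absolutely continuous; for all weights it
    bounds the norm of the density by duality. The opposite bound tests the plan
    against nearly optimal admissible weights. *)
Lemma exists_optimal_plan (R : realType) (X : completeMetricType R)
    (m : {measure set (borel X) -> \bar R}) (m_bounded : finite_on_bounded m)
    (p : R) (p_ge1 : 1 <= p) (lambda : {nonneg R})
    (Gamma : set (curve X)) (Gamma_rect : Gamma `<=` @rectifiable R X)
    (Gamma_compact : compact Gamma)
    (Mod_gt0 : (0 < modulus m lambda%:num p Gamma)%E)
    (Mod_lty : (modulus m lambda%:num p Gamma < +oo)%E) :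
  exists pi : probability (borel (curve X)) R,
    [/\ pi Gamma = 1%E,
        admits_barycenter m lambda%:num (hoelder_conjugate p%:E) pi &
        ('N[m]_(hoelder_conjugate p%:E) [barycenter m lambda%:num pi] =
         modulus m lambda%:num p Gamma `^ (- p^-1))%E].
Proof.
have p_gt0 : 0 < p by exact: lt_le_trans p_ge1.
have mG : measurable (Gamma : set (borel (curve X))).
  by apply: borel_closed; apply: compact_closed => //; exact: metric_hausdorff.
have M_gt0 := inverse_modulus_gt0 Mod_gt0 Mod_lty.
have [pi [piG nuN]] :=
  optimal_measure m_bounded p_ge1 Gamma_rect Gamma_compact Mod_gt0 Mod_lty.
rewrite (inverse_modulusE Mod_gt0 Mod_lty).
set M := inverse_modulus _ _ _ _ in M_gt0 nuN *.
pose nu : {measure set (borel X) -> \bar R} := mixture lambda pi.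
have nu_le A : measurable A -> (nu A <= M%:E * m A `^ p^-1)%E.
  move=> mA; have := nuN (fun x => (1 * \1_A x)%:E).
  rewrite Lnorm_scale_indic// mul1e => h.
  have <- : (\int[nu]_x (1 * \1_A x)%:E = nu A)%E.
    under eq_integral do rewrite mul1r.
    by rewrite integral_indic// setIT.
  by apply: h => //; apply/measurable_EFinP; apply: measurable_funM.
have nu_exhaustion n : (nu (@exhaustion R X n) < +oo)%E.
  apply: le_lt_trans (nu_le _ (@exhaustion_measurable R X n)) _.
  apply: lte_mul_pinfty; rewrite ?lee_fin ?(ltW M_gt0)//.
  by apply: poweR_lty; exact: exhaustion_lty.
have nu_m : nu `<< m.
  apply/null_content_dominatesP => A mA mA0; apply/eqP; rewrite -measure_le0.
  by apply: le_trans (nu_le _ mA) _; rewrite mA0 poweR0r ?invr_eq0 ?gt_eqF// mule0.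
have densityE f : is_density m (plan_measure lambda%:num pi) f <-> is_density m nu f.
  split=> -[mf f0 fE]; split => // A mA; first by rewrite -fE// plan_measureE.
  by rewrite plan_measureE// fE.
set bar := barycenter m lambda%:num pi.
have bar_density : is_density m (plan_measure lambda%:num pi) bar.
  apply: (@xgetPex _ (cst 0%E) [set f | is_density m (plan_measure lambda%:num pi) f]).
  have [f nuf] := density_ex m_bounded nu_exhaustion nu_m.
  by exists f; apply/densityE.
have nu_bar : is_density m nu bar by apply/densityE.
have [mbar bar0 _] := nu_bar.
have bar_le : ('N[m]_(hoelder_conjugate p%:E)[bar] <= M%:E)%E.
  apply: (@dual_Lnorm _ _ _ m p p_ge1 (@exhaustion R X)) => //.
  - exact: exhaustion_measurable.
  - by move=> n; exact: exhaustion_lty.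
  - exact: exhaustion_le.
  - exact: exhaustionT.
  - exact: ltW.
  - by move=> g mg g0; rewrite -(integral_density nu_bar)//; exact: nuN.
have bar_lty : ('N[m]_(hoelder_conjugate p%:E)[bar] < +oo)%E.
  by apply: le_lt_trans bar_le _; rewrite ltry.
exists pi; split => //.
- split => //.
  + exists (~` Gamma); split => //; first exact: measurableC.
      by have := probability_setC pi mG; rewrite piG subee.
    exact: subsetC.
  + apply/null_content_dominatesP => A mA mA0; rewrite plan_measureE//.
    exact: (proj1 (null_content_dominatesP _ _) nu_m).
have [r rE] : exists r : R, ('N[m]_(hoelder_conjugate p%:E)[bar] = r%:E)%E.
  have : 'N[m]_(hoelder_conjugate p%:E)[bar]%E \is a fin_num.
    by rewrite ge0_fin_numE// Lnorm_ge0.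
  by move=> /fineK <-; eexists.
apply/eqP; rewrite eq_le bar_le/= leNgt; apply/negP; rewrite rE lte_fin => rM.
have r0 : 0 <= r by rewrite -lee_fin -rE Lnorm_ge0.
(* If the norm [r] were less than [M], some admissible [rho] would have norm at
   most [1/s] with [r < s < M], and Hoelder would give [1 <= r / s]. *)
pose s := (r + M) / 2.
have s0 : 0 < s by rewrite /s; lra.
have [|rho Arho rho_s] := @admissible_Lnorm_lt _ _ _ _ _ _ p_ge1 Mod_gt0 Mod_lty s^-1.
  by rewrite ltf_pV2 ?posrE// -/M /s; lra.
have [mrho rho0 rhoG] := Arho.
have le1 : (1 <= \int[nu]_x rho x)%E.
  have [mJ ->] := @integral_plan_mixture R X lambda pi _ mrho rho0.
  have <- : (\int[pi]_g (\1_Gamma g)%:E)%E = 1%E by rewrite integral_indic// setIT.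
  apply: ge0_le_integral => //.
    by apply/measurable_EFinP; exact: measurable_indic.
  move=> g _; rewrite indicE; case: (boolP (g \in Gamma)) => [/set_mem Gg|_].
    by rewrite integral_path_kernel//; exact: rhoG.
  exact: integral_ge0.
have : (1 <= (s^-1 * r)%:E)%E.
  apply: (le_trans le1); rewrite (integral_density nu_bar)// EFinM -rE.
  apply: le_trans (hoelder_ge0 p_ge1 mrho mbar rho0 bar0 _ bar_lty) _.
    by apply: le_lt_trans rho_s _; rewrite ltry.
  by rewrite lee_wpmul2r// Lnorm_ge0.
rewrite lee_fin ler_pdivlMl// mulr1 leNgt => /negP; apply.
by rewrite /s; lra.
Qed.

Theorem proposition3p20 (R : realType) (X : completeMetricType R)
    (sepX : separable X)
    (m : {measure set (borel X) -> \bar R}) (m_bounded : finite_on_bounded m)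
    (p : R) (p_ge1 : 1 <= p)
    (lambda : R) (lambda01 : lambda = 0 \/ lambda = 1)
    (Gamma : set (curve X)) (Gamma_rect : Gamma `<=` @rectifiable R X)
    (Gamma_compact : compact Gamma)
    (Mod_gt0 : (0 < modulus m lambda p Gamma)%E)
    (Mod_lty : (modulus m lambda p Gamma < +oo)%E) :
  exists pi : probability (borel (curve X)) R,
    [/\ pi Gamma = 1%E,
        admits_barycenter m lambda (hoelder_conjugate p%:E) pi &
        ('N[m]_(hoelder_conjugate p%:E) [barycenter m lambda pi] =
         modulus m lambda p Gamma `^ (- p^-1))%E].
Proof.
have lambda0 : 0 <= lambda by case: lambda01 => ->.
exact: (@exists_optimal_plan R X m m_bounded p p_ge1 (NngNum lambda0)).
Qed.
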